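(* Let $G$ be a group which admits a c$\mathcal{Z}$-structure based on a model $\mathcal{Z}$-geometry $(\overline X,Z,d)$. Then for every integer $n$ and every principal ideal domain $R$, $$H^{n+1}(G,RG)\cong\widetilde{\check H}{}^{n}(Z;R).$$
   Context: $H^{*}(G,RG)$ is group cohomology with coefficients in the group ring $RG$. $\widetilde{\check H}{}^{*}(\ ;R)$ is reduced Čech cohomology (Čech--Alexander--Spanier cohomology) with coefficients in $R$, i.e. computed from the augmented complex. All spaces are separable and metrizable. Coarse near-actions. Let $(X,d)$ and $(Y,d')$ be metric spaces. Let $\rho_-,\rho_+:[0,\infty)\to[0,\infty)$ be nondecreasing with $\rho_-(r)\to\infty$ as $r\to\infty$. A (not necessarily continuous) function $f:X\to Y$ is a $(\rho_-,\rho_+)$-coarse embedding if $\rho_-(d(x_1,x_2))\le d'(f(x_1),f(x_2))\le\rho_+(d(x_1,x_2))$ for all $x_1,x_2\in X$. A coarse near-action of a group $G$ on $(X,d)$ is a function $\psi$ assigning to each $\gamma\in G$ a function $\psi(\gamma):X\to X$ such that, for some $C\ge 0$ and some such pair $(\rho_-,\rho_+)$ (independent of $\gamma$): $d(\psi(1)(x),x)\le C$ for all $x\in X$; $d(\psi(\gamma_1\gamma_2)(x),\psi(\gamma_1)\psi(\gamma_2)(x))\le C$ for all $x\in X$, $\gamma_1,\gamma_2\in G$; and every $\psi(\gamma)$ is a $(\rho_-,\rho_+)$-coarse embedding. It is cobounded if there exist $x_0\in X$ and $R_0>0$ such that for all $y\in X$ there is $\gamma\in G$ with $d(\psi(\gamma)(x_0),y)<R_0$.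 It is proper if for each $r>0$ there is $M\in\mathbb{N}$ such that for all $x,y\in X$, $|\{\gamma\in G : \psi(\gamma)(B_d[x,r])\cap B_d[y,r]\ne\emptyset\}|\le M$, where $B_d[x,r]$ is the closed ball. Model $\mathcal{Z}$-geometries. An ANR is a locally compact (separable metrizable) space $X$ such that whenever $X$ is embedded as a closed subset of another space $Y$, some neighborhood of $X$ in $Y$ retracts onto $X$; an AR is a contractible ANR. A metric space is proper if all closed balls are compact; it is cocompact if there are $x_0\in X$, $r>0$ such that the balls $B_d[\gamma x_0,r]$, $\gamma\in\operatorname{Isom}(X)$, cover $X$. A model geometry is a proper, cocompact metric AR $(X,d)$. A closed subset $A$ of a space $Y$ is a $\mathcal{Z}$-set if there is a homotopy $H:Y\times[0,1]\to Y$ with $H_0=\operatorname{id}_Y$ and $H_t(Y)\subset Y-A$ for all $t>0$. A $\mathcal{Z}$-compactification of $X$ is a compactification $\overline X=X\sqcup Z$ with $Z$ a $\mathcal{Z}$-set in $\overline X$. It is controlled (with respect to $d$) if for every $r>0$ and every open cover $\mathcal{U}$ of $\overline X$ there is a compact set $C\subset X$ such that every $A\subseteq X-C$ with $\operatorname{diam}_d A<r$ is contained in some $U\in\mathcal{U}$. A model $\mathcal{Z}$-geometry $(\overline X,Z,d)$ is a controlled $\mathcal{Z}$-compactification $\overline X=X\sqcup Z$ of a model geometry $(X,d)$. A coarse $\mathcal{Z}$-structure (c$\mathcal{Z}$-structure) on a group $G$, based on $(\overline X,Z,d)$, consists of a model $\mathcal{Z}$-geometry $(\overline X,Z,d)$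 together with a proper, cobounded, coarse near-action of $G$ on $(X,d)$. *)

(* Defs.v *)
From HB Require Import structures.
From mathcomp Require Import all_boot all_order all_algebra.
From mathcomp Require Import generic_quotient ring_quotient zify.
From mathcomp Require Import all_classical all_reals.
From mathcomp Require Import ereal topology normedtype.

Set Implicit Arguments.
Unset Strict Implicit.
Unset Printing Implicit Defensive.

Import Order.TTheory GRing.Theory Num.Theory.
Import numFieldNormedType.Exports.

Local Open Scope classical_set_scope.
Local Open Scope ring_scope.

Definition is_ideal (R : comNzRingType) (I : set R) : Prop :=
  [/\ I 0, forall x y, I x -> I y -> I (x + y) & forall a x, I x -> I (a * x)].

Definition is_PID (R : idomainType) : Prop :=
  forall I : set R, is_ideal I -> exists a : R, I = [set x * a | x in [set: R]].

Definition lmod_isomorphic (R : comNzRingType) (V W : lmodType R) : Prop :=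
  exists f : {linear V -> W}, bijective f.

Section Submodule.
Variables (R : comNzRingType) (V : lmodType R) (S : submodClosed V).

Definition submod : Type := {x : V | x \in S}.

HB.instance Definition _ := SubChoice.on submod.
HB.instance Definition _ := [SubChoice_isSubLmodule of submod by <:].

End Submodule.

Section RestrictLinear.
Variables (R : comNzRingType) (V W : lmodType R).
Variables (S : submodClosed V) (T : submodClosed W) (f : {linear V -> W}).
Hypothesis fST : forall x, x \in S -> f x \in T.

Definition submod_map (x : submod S) : submod T := exist _ (f (val x)) (fST (valP x)).

Lemma submod_map_is_linear : linear submod_map.
Proof. by move=> a x y; apply: val_inj; rewrite /= !linearP. Qed.

HB.instance Definition _ :=
  GRing.isLinear.Build R (submod S) (submod T) _ submod_map submod_map_is_linear.

End RestrictLinear.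

Section QuotientModule.
Local Open Scope quotient_scope.
Variables (R : comNzRingType) (V : lmodType R) (S : submodClosed V).

(* submodClosed does not inherit from zmodClosed, which Quotient.quot expects. *)
Definition modulus : {pred V} := fun x => x \in S.

HB.instance Definition _ :=
  GRing.isZmodClosed.Build V modulus (submodClosedP S : zmod_closed modulus).

Definition quotmod : Type := Quotient.quot modulus.

HB.instance Definition _ := GRing.Zmodule.on quotmod.

Definition to_quot (x : V) : quotmod := \pi_(Quotient.quot modulus) x.
Definition of_quot (x : quotmod) : V := repr (x : Quotient.quot modulus).

Lemma of_quotK : cancel of_quot to_quot.
Proof. exact: reprK. Qed.

Lemma to_quotD : {morph to_quot : x y / x + y}.
Proof. exact: raddfD. Qed.

Lemma to_quot_eqP (x y : V) : to_quot x = to_quot y <-> x - y \in S.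
Proof. by rewrite -[x - y \in S]/(x - y \in modulus) Quotient.idealrBE; split=> [/eqP|/eqP]. Qed.

Definition scale_quot (a : R) (x : quotmod) : quotmod := to_quot (a *: of_quot x).

Lemma to_quotZ a x : to_quot (a *: x) = scale_quot a (to_quot x).
Proof.
apply/to_quot_eqP; rewrite -scalerBr rpredZ//.
by apply/to_quot_eqP; rewrite of_quotK.
Qed.

Lemma scale_quotA a b x : scale_quot a (scale_quot b x) = scale_quot (a * b) x.
Proof. by rewrite -(of_quotK x) -!to_quotZ scalerA. Qed.

Lemma scale_quot1 : left_id 1 scale_quot.
Proof. by move=> x; rewrite -(of_quotK x) -!to_quotZ scale1r. Qed.

Lemma scale_quotDr : right_distributive scale_quot +%R.
Proof.
move=> a x y; rewrite -(of_quotK x) -(of_quotK y).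
by rewrite -to_quotD -!to_quotZ -to_quotD scalerDr.
Qed.

Lemma scale_quotDl x : {morph scale_quot^~ x : a b / a + b}.
Proof.
by move=> a b; rewrite -(of_quotK x) -!to_quotZ -to_quotD scalerDl.
Qed.

HB.instance Definition _ := GRing.Zmodule_isLmodule.Build R quotmod
  scale_quotA scale_quot1 scale_quotDr scale_quotDl.

Lemma to_quot_is_linear : linear to_quot.
Proof. by move=> a x y; rewrite to_quotD to_quotZ. Qed.

HB.instance Definition _ :=
  GRing.isLinear.Build R V quotmod _ to_quot to_quot_is_linear.

End QuotientModule.

Section QuotientLinear.
Variables (R : comNzRingType) (V W : lmodType R).
Variables (S : submodClosed V) (T : submodClosed W) (f : {linear V -> W}).
Hypothesis fST : forall x, x \in S -> f x \in T.

(* The argument fST is recorded so that linearity can be inferred. *)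
Definition quotmod_map (x : quotmod S) : quotmod T :=
  let _ := fST in to_quot T (f (of_quot x)).

Lemma quotmod_mapE x : quotmod_map (to_quot S x) = to_quot T (f x).
Proof.
apply/to_quot_eqP; rewrite -linearB; apply: fST.
by apply/to_quot_eqP; rewrite of_quotK.
Qed.

Lemma quotmod_map_is_linear : linear quotmod_map.
Proof.
move=> a x y; rewrite -(of_quotK x) -(of_quotK y).
by rewrite -linearP !quotmod_mapE !linearP.
Qed.

HB.instance Definition _ :=
  GRing.isLinear.Build R (quotmod S) (quotmod T) _ quotmod_map quotmod_map_is_linear.

End QuotientLinear.

Record cochain_complex (R : comNzRingType) := CochainComplex {
  cochain :> nat -> lmodType R;
  differential : forall n, {linear cochain n -> cochain n.+1};
  differentialK : forall n x, differential n.+1 (differential n x) = 0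
}.

Section Cohomology.
Variables (R : comNzRingType) (C : cochain_complex R).

Definition cocycle n : {pred C n} := fun x => differential C n x == 0.

Lemma cocycle_closed n : submod_closed (@cocycle n).
Proof.
split; first by rewrite unfold_in linear0.
by move=> a x y; rewrite !unfold_in linearP => /eqP-> /eqP->; rewrite scaler0 addr0.
Qed.

HB.instance Definition _ n :=
  GRing.isSubmodClosed.Build R (C n) (@cocycle n) (@cocycle_closed n).

Definition coboundary n : {pred submod (@cocycle n)} :=
  match n return {pred submod (@cocycle n)} with
  | 0 => fun x => x == 0
  | m.+1 => fun x => `[< exists y : C m, differential C m y = val x >]
  end.

Lemma coboundary_closed n : submod_closed (@coboundary n).
Proof.
case: n => [|n]; split.
- by rewrite unfold_in.
- by move=> a x y; rewrite !unfold_in => /eqP-> /eqP->; rewrite scaler0 addr0.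
- by rewrite unfold_in; apply/asboolP; exists 0; rewrite linear0.
- move=> a x y; rewrite !unfold_in => /asboolP[u uE] /asboolP[v vE].
  by apply/asboolP; exists (a *: u + v); rewrite linearP uE vE.
Qed.

HB.instance Definition _ n :=
  GRing.isSubmodClosed.Build R (submod (@cocycle n)) (@coboundary n)
    (@coboundary_closed n).

(* Complexes are concentrated in degrees >= 0, so cohomology vanishes in
   negative degrees; 'rV[R]_0 is the zero module. *)
Definition cohomology (n : int) : lmodType R :=
  match n with
  | Posz m => quotmod (@coboundary m)
  | Negz _ => 'rV[R]_0
  end.

End Cohomology.

(* A function of k vertices: for k = 0 the only argument is the empty tuple, and
   the differential from k = 0 to k = 1 sends a constant to the constant
   function, i.e. it is the augmentation. *)
Section SimplicialDifferential.
Variables (R : comNzRingType) (T : Type) (V : lmodType R).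

Definition simplicial_d k (f : ('I_k -> T) -> V) : ('I_k.+1 -> T) -> V :=
  fun x => \sum_(i < k.+1) (-1) ^+ i *: f (fun j => x (lift i j)).

Lemma simplicial_d_is_linear k : linear (@simplicial_d k).
Proof.
move=> a f g; apply/funext => x.
rewrite /simplicial_d !fctE scaler_sumr -big_split /=; apply: eq_bigr => i _.
by rewrite scalerDr !scalerA mulrC.
Qed.

HB.instance Definition _ k := GRing.isLinear.Build R
  (('I_k -> T) -> V) (('I_k.+1 -> T) -> V) _ (@simplicial_d k)
  (@simplicial_d_is_linear k).

Lemma simplicial_dK k (f : ('I_k -> T) -> V) : simplicial_d (simplicial_d f) = 0.
Proof.
apply/funext => x; rewrite /simplicial_d.
transitivity (\sum_(p : 'I_k.+2 * 'I_k.+1)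
  (-1) ^+ (p.1 + p.2) *: f (fun j => x (lift p.1 (lift p.2 j)))).
  rewrite -(pair_bigA _ (fun (p1 : 'I_k.+2) (p2 : 'I_k.+1) =>
    (-1) ^+ (p1 + p2) *: f (fun j => x (lift p1 (lift p2 j)))))/=.
  apply: eq_bigr => i _; rewrite scaler_sumr; apply: eq_bigr => j _.
  by rewrite scalerA -exprD.
pose h (p : 'I_k.+2 * 'I_k.+1) : 'I_k.+2 * 'I_k.+1 :=
  (lift p.1 p.2, inord (if p.2 < p.1 then p.1.-1 else p.1)%N).
have hv2 p : (h p).2 = (if p.2 < p.1 then p.1.-1 else p.1)%N :> nat.
  by case: p => -[p Hp] [q Hq]; rewrite /h/= inordK//; case: ifP; lia.
have hv1 p : (h p).1 = (if p.2 < p.1 then p.2 : nat else p.2.+1)%N :> nat.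
  by rewrite /= /bump; case: ltnP; lia.
clearbody h.
have hK : involutive h.
  move=> p; move: (hv1 p) (hv2 p) (hv1 (h p)) (hv2 (h p)).
  case: (h (h p)) => [a b]; case: (h p) => [c d]; case: p => [p q] /=.
  move=> e1 e2 e3 e4.
  by apply: injective_projections; apply: val_inj => /=;
    move: e3 e4; rewrite e1 e2; clear e1 e2; do !case: ifP; lia.
rewrite (bigID (fun p : 'I_k.+2 * 'I_k.+1 => (p.2 < p.1)%N)) /=.
rewrite [X in _ + X](reindex h) /=; last by exists h => p _; exact: hK.
rewrite [X in _ + X](eq_bigl (fun p : 'I_k.+2 * 'I_k.+1 => (p.2 < p.1)%N)).
  rewrite -big_split big1 //= => p pP.
  have -> : (fun j => x (lift (h p).1 (lift (h p).2 j))) =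
            (fun j => x (lift p.1 (lift p.2 j))).
    apply/funext => j; congr (x _); apply: val_inj => /=.
    rewrite hv1 hv2 pP.
    by move: (p.1 : nat) (p.2 : nat) (j : nat) pP => a b c; rewrite /bump; lia.
  rewrite -scalerDl (_ : _ + _ = 0) ?scale0r// hv1 hv2 pP.
  move: (p.1 : nat) (p.2 : nat) pP => [|a] b //= _.
  by rewrite addSn exprS mulN1r addnC addNr.
move=> p; rewrite hv1 hv2.
by move: (p.1 : nat) (p.2 : nat) => a b; do !case: ifP; lia.
Qed.

End SimplicialDifferential.

Record gmodule (G : groupType) (R : comNzRingType) := GModule {
  gmod :> lmodType R;
  gact : G -> {linear gmod -> gmod};
  gact1 : forall v, gact 1%g v = v;
  gactM : forall g h v, gact (g * h)%g v = gact g (gact h v)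
}.

(* Homogeneous cochains: Hom_G(-, M) of the standard free resolution of the
   trivial module. *)
Section GroupCohomology.
Variables (G : groupType) (R : comNzRingType) (M : gmodule G R).

Definition equivariant n : {pred ('I_n.+1 -> G) -> M} :=
  fun f => `[< forall (g : G) (x : 'I_n.+1 -> G),
                 f (fun i => (g * x i)%g) = gact M g (f x) >].

Lemma equivariant_closed n : submod_closed (@equivariant n).
Proof.
split; first by rewrite unfold_in; apply/asboolP => g x; rewrite linear0.
move=> a u v; rewrite !unfold_in => /asboolP uE /asboolP vE.
by apply/asboolP => g x; rewrite !fctE uE vE linearP.
Qed.

HB.instance Definition _ n := GRing.isSubmodClosed.Build R
  (('I_n.+1 -> G) -> M) (@equivariant n) (@equivariant_closed n).

Lemma equivariant_d n f :
  f \in @equivariant n -> simplicial_d f \in @equivariant n.+1.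
Proof.
rewrite !unfold_in => /asboolP fE; apply/asboolP => g x.
rewrite /simplicial_d linear_sum; apply: eq_bigr => i _.
by rewrite linearZ /= -fE.
Qed.

Definition group_cochain n : lmodType R := submod (@equivariant n).

Definition group_d n : {linear group_cochain n -> group_cochain n.+1} :=
  submod_map (@equivariant_d n).

Lemma group_dK n x : group_d n.+1 (group_d n x) = 0.
Proof. by apply: val_inj; exact: simplicial_dK. Qed.

Definition group_complex : cochain_complex R := CochainComplex group_dK.

Definition group_cohomology (n : int) : lmodType R := cohomology group_complex n.

End GroupCohomology.

(* The group ring RG as a left G-module: finitely supported functions G -> R
   (the function a stands for the sum of the a h *: h), on which g acts by left
   multiplication. *)
Section GroupRing.
Variables (G : groupType) (R : comNzRingType).

Definition finitely_supported : {pred G -> R^o} :=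
  fun a => `[< finite_set [set h | a h != 0] >].

Lemma finitely_supported_closed : submod_closed finitely_supported.
Proof.
split.
  rewrite unfold_in; apply/asboolP; rewrite (_ : [set _ | _] = set0)//.
  by apply/seteqP; split=> h //=; rewrite eqxx.
move=> c a b; rewrite !unfold_in => /asboolP fa /asboolP fb; apply/asboolP.
apply: (@sub_finite_set _ _ ([set h | a h != 0] `|` [set h | b h != 0])).
  move=> h /=; rewrite !fctE; apply: contra_neqP => /not_orP[/negP + /negP].
  by rewrite !negbK => /eqP-> /eqP->; rewrite scaler0 addr0.
by rewrite finite_setU.
Qed.

HB.instance Definition _ := GRing.isSubmodClosed.Build R
  (G -> R^o) finitely_supported finitely_supported_closed.

Definition left_translate (g : G) (a : G -> R^o) : G -> R^o :=
  fun h => a (g^-1 * h)%g.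

Lemma left_translate_is_linear g : linear (left_translate g).
Proof. by []. Qed.

HB.instance Definition _ g := GRing.isLinear.Build R (G -> R^o) (G -> R^o) _
  (left_translate g) (left_translate_is_linear g).

Lemma left_translate_finite g a :
  a \in finitely_supported -> left_translate g a \in finitely_supported.
Proof.
rewrite !unfold_in => /asboolP fa; apply/asboolP.
apply: (@sub_finite_set _ _ ((fun h => (g * h)%g) @` [set h | a h != 0])).
  by move=> h /= ah; exists (g^-1 * h)%g => //; rewrite mulgA mulgV mul1g.
exact: finite_image.
Qed.

Definition group_ring_act (g : G) :
    {linear submod finitely_supported -> submod finitely_supported} :=
  submod_map (@left_translate_finite g).

Lemma group_ring_act1 v : group_ring_act 1%g v = v.
Proof.
by apply/val_inj/funext => h; rewrite /= /left_translate invg1 mul1g.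
Qed.

Lemma group_ring_actM g h v :
  group_ring_act (g * h)%g v = group_ring_act g (group_ring_act h v).
Proof.
by apply/val_inj/funext => k; rewrite /= /left_translate invgM mulgA.
Qed.

Definition group_ring : gmodule G R :=
  GModule group_ring_act1 group_ring_actM.

End GroupRing.

Section AlexanderSpanier.
Variables (R : comNzRingType) (T : topologicalType).

(* k counts vertices, so k.+1 vertices is degree k, and k = 0 is the augmentation
   term R in degree -1, of which no quotient is taken. *)
Definition locally_zero k : {pred ('I_k -> T) -> R^o} :=
  match k return {pred ('I_k -> T) -> R^o} with
  | 0 => fun f => f == 0
  | k'.+1 => fun f => `[< forall t : T, exists2 A, nbhs t A &
      forall x : 'I_k'.+1 -> T, (forall i, A (x i)) -> f x = 0 >]
  end.

Lemma locally_zero_closed k : submod_closed (@locally_zero k).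
Proof.
case: k => [|k]; split.
- by rewrite unfold_in.
- by move=> a x y; rewrite !unfold_in => /eqP-> /eqP->; rewrite scaler0 addr0.
- by rewrite unfold_in; apply/asboolP => t; exists setT => //; exact: filterT.
- move=> a u v; rewrite !unfold_in => /asboolP uP /asboolP vP; apply/asboolP => t.
  have [A tA uA] := uP t; have [B tB vB] := vP t.
  exists (A `&` B); first exact: filterI.
  move=> x xAB; rewrite !fctE uA ?vB ?scaler0 ?addr0// => i.
    by have [] := xAB i.
  by have [] := xAB i.
Qed.

HB.instance Definition _ k := GRing.isSubmodClosed.Build R
  (('I_k -> T) -> R^o) (@locally_zero k) (@locally_zero_closed k).

Lemma locally_zero_d k f :
  f \in @locally_zero k -> simplicial_d f \in @locally_zero k.+1.
Proof.
case: k f => [|k] f; rewrite !unfold_in.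
  by move=> /eqP->; apply/asboolP => t; exists setT => [|x _];
    [exact: filterT | rewrite linear0].
move=> /asboolP fP; apply/asboolP => t; have [A tA fA] := fP t.
exists A => // x xA; rewrite /simplicial_d big1// => i _.
by rewrite fA ?scaler0.
Qed.

Definition AS_cochain k : lmodType R := quotmod (@locally_zero k).

Definition AS_d k : {linear AS_cochain k -> AS_cochain k.+1} :=
  quotmod_map (@locally_zero_d k).

Lemma AS_dK k x : AS_d k.+1 (AS_d k x) = 0.
Proof.
transitivity (to_quot (@locally_zero k.+2) (simplicial_d (simplicial_d (of_quot x)))).
  by rewrite -{1}(of_quotK x) /= !quotmod_mapE.
by rewrite simplicial_dK linear0.
Qed.

Definition augmented_AS_complex : cochain_complex R := CochainComplex AS_dK.

(* The shift by one accounts for the augmentation term sitting in degree -1. *)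
Definition reduced_cech_cohomology (n : int) : lmodType R :=
  cohomology augmented_AS_complex (n + 1).

End AlexanderSpanier.

Section Topology.
Variable K : realType.

Definition metrizable (T : topologicalType) : Prop :=
  exists d : T -> T -> K,
    [/\ forall x y, d x y = 0 <-> x = y,
        forall x y, d x y = d y x,
        forall x y z, d x z <= d x y + d y z &
        forall x (A : set T),
          nbhs x A <-> exists2 e, 0 < e & [set y | d x y < e] `<=` A].

Definition separable (T : topologicalType) : Prop :=
  exists2 D : set T, countable D & dense D.

Definition separable_metrizable (T : topologicalType) : Prop :=
  separable T /\ metrizable T.

Definition embedding (S T : topologicalType) (f : S -> T) : Prop :=
  [/\ injective f, continuous f &
      forall U : set S, open U -> exists2 V : set T, open V & U = f @^-1` V].

(* r is only relevant on U; it maps T to T, and not to A, so that A may be empty. *)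
Definition retraction_on (T : topologicalType) (U A : set T) (r : T -> T) : Prop :=
  [/\ {within U, continuous r}, r @` U `<=` A & forall a, A a -> r a = a].

Definition is_ANR (X : topologicalType) : Prop :=
  [/\ locally_compact [set: X], separable_metrizable X &
      forall (Y : topologicalType) (f : X -> Y), separable_metrizable Y ->
        embedding f -> closed (range f) ->
        exists2 U : set Y, range f `<=` interior U &
          exists r, retraction_on U (range f) r].

Definition contractible (X : topologicalType) : Prop :=
  exists (x0 : X) (H : X * K -> X),
    [/\ {within [set: X] `*` `[0, 1]%classic, continuous H},
        forall x, H (x, 0) = x & forall x, H (x, 1) = x0].

Definition is_AR (X : topologicalType) : Prop := is_ANR X /\ contractible X.

Definition is_Zset (Y : topologicalType) (A : set Y) : Prop :=
  closed A /\ exists H : Y * K -> Y,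
    [/\ {within [set: Y] `*` `[0, 1]%classic, continuous H},
        forall y, H (y, 0) = y &
        forall y t, 0 < t <= 1 -> ~ A (H (y, t))].

End Topology.

Section ModelGeometry.
Variables (K : realType) (X : metricType K).

(* The library's closed_ball is the closure of the open ball, which may be
   smaller than this. *)
Definition cball (x : X) (r : K) : set X := [set y | mdist x y <= r].

Definition proper_metric : Prop := forall x r, compact (cball x r).

Definition is_isometry (g : X -> X) : Prop :=
  bijective g /\ forall x y, mdist (g x) (g y) = mdist x y.

Definition cocompact : Prop :=
  exists (x0 : X) (r : K), 0 < r /\
    forall y, exists2 g, is_isometry g & cball (g x0) r y.

(* diam set0 is -oo, which is harmless as only upper bounds on diam are used. *)
Definition diam (A : set X) : \bar K :=
  ereal_sup [set (mdist p.1 p.2)%:E | p in A `*` A].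

Definition model_geometry : Prop := [/\ proper_metric, cocompact & is_AR K X].

Variables (Xbar : topologicalType) (i : X -> Xbar).

Definition boundary : set Xbar := ~` range i.

Definition compactification : Prop :=
  [/\ compact [set: Xbar], separable_metrizable K Xbar, embedding i &
      dense (range i)].

Definition Z_compactification : Prop := compactification /\ is_Zset K boundary.

Definition open_cover (U : set (set Xbar)) : Prop :=
  (forall V, U V -> open V) /\ \bigcup_(V in U) V = setT.

Definition controlled : Prop :=
  forall (r : K) (U : set (set Xbar)), 0 < r -> open_cover U ->
    exists2 C : set X, compact C &
      forall A : set X, A `<=` ~` C -> (diam A < r%:E)%E ->
        exists2 V, U V & i @` A `<=` V.

Definition model_Z_geometry : Prop :=
  [/\ model_geometry, Z_compactification & controlled].

End ModelGeometry.

Section CoarseNearAction.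
Variables (K : realType).

Definition control_functions (rho_lo rho_up : K -> K) : Prop :=
  [/\ forall r, 0 <= r -> 0 <= rho_lo r /\ 0 <= rho_up r,
      forall r s, 0 <= r <= s -> rho_lo r <= rho_lo s,
      forall r s, 0 <= r <= s -> rho_up r <= rho_up s &
      rho_lo r @[r --> +oo] --> +oo].

Definition coarse_embedding (X Y : metricType K) (rho_lo rho_up : K -> K)
    (f : X -> Y) : Prop :=
  forall x1 x2, rho_lo (mdist x1 x2) <= mdist (f x1) (f x2) <= rho_up (mdist x1 x2).

Variables (G : groupType) (X : metricType K) (psi : G -> X -> X).

Definition coarse_near_action : Prop :=
  exists (C : K) (rho_lo rho_up : K -> K),
    [/\ 0 <= C, control_functions rho_lo rho_up,
        forall x, mdist (psi 1%g x) x <= C,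
        forall g h x, mdist (psi (g * h)%g x) (psi g (psi h x)) <= C &
        forall g, coarse_embedding rho_lo rho_up (psi g)].

Definition cobounded : Prop :=
  exists (x0 : X) (R0 : K), 0 < R0 /\
    forall y, exists g, mdist (psi g x0) y < R0.

Definition proper_near_action : Prop :=
  forall r : K, 0 < r -> exists M : nat, forall x y : X,
    ([set g | psi g @` cball x r `&` cball y r !=set0] #<= `I_M)%card.

End CoarseNearAction.

Definition cZ_structure (K : realType) (G : groupType) (X : metricType K)
    (Xbar : topologicalType) (i : X -> Xbar) (psi : G -> X -> X) : Prop :=
  [/\ model_Z_geometry i, coarse_near_action psi, cobounded psi &
      proper_near_action psi].

(* Main.v *)
(* Both sides are compared with the cohomology of X with bounded (i.e. compact) supports,
   everything being computed with arbitrary functions on finite tuples of points.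

   A cochain with coefficients in RG is a function phi on tuples of G such that
   h |-> phi (h x) has finite support for each tuple x. It is an edge of the double complex
   of functions phi on G^p x X^q, taken modulo functions that are locally zero in the
   variables from X, such that for each x and r only finitely many h have phi (h x, .) not
   locally zero on the r-ball around h x0. The rows are exact, by prepending to x a group
   element moving x0 close to the first point in X. The columns are exact because X is
   contractible and cocompact, so that each ball contracts inside a larger ball of uniform
   radius: an Alexander-Spanier cocycle on X has a primitive that vanishes on a ball as
   soon as the cocycle vanishes on a suitable larger ball. The other edge consists of
   the Alexander-Spanier cochains of X with bounded support.

   The compactification is acyclic, since it can be pushed into X and then contracted;
   hence the cohomology of X with bounded supports is, up to a shift of degree, that of
   the germs of cochains along Z, and by tautness the latter is the cohomology of Z. *)
Require Import Defs.
From HB Require Import structures.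
From mathcomp Require Import all_boot all_order all_algebra.
From mathcomp Require Import zify lra.
From mathcomp Require Import all_classical all_reals.
From mathcomp Require Import ereal topology normedtype.

Set Implicit Arguments.
Unset Strict Implicit.
Unset Printing Implicit Defensive.

Import Order.TTheory GRing.Theory Num.Theory.
Import numFieldNormedType.Exports.

Local Open Scope classical_set_scope.
Local Open Scope ring_scope.

(** For primitives built along a homotopy: if [u] agrees with [q] and [v] with [q - p] as germs,
    then [u - v] agrees with [p]. In use [u] and [v] are coboundaries. *)
Lemma subr_detour (V : zmodType) (p q u v : V) : p - (u - v) = q - u - (q - p - v).
Proof.
rewrite !opprB -[q - u + _]addrA [q + _]addrC !addrA subrK.
by rewrite [RHS]addrC [- u + v]addrC addrA.
Qed.

(** * Isomorphisms of subquotients *)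

Section SubquotientIso.
Variable R : comNzRingType.

(* An isomorphism Z_V / B_V -> Z_W / B_W given by its graph, which spares the
   construction of chain maps. *)
Definition subquotient_iso (V W : lmodType R) (ZV BV : set V) (ZW BW : set W) :=
  exists Rel : V -> W -> Prop,
  [/\ forall a v v' w w', Rel v w -> Rel v' w' -> Rel (a *: v + v') (a *: w + w'),
      forall v w, Rel v w -> [/\ ZV v, ZW w & BV v <-> BW w],
      forall v, ZV v -> exists w, Rel v w &
      forall w, ZW w -> exists v, Rel v w].

Lemma subquotient_iso_trans (U V W : lmodType R) (ZU BU : set U) (ZV BV : set V)
    (ZW BW : set W) :
  subquotient_iso ZU BU ZV BV -> subquotient_iso ZV BV ZW BW ->
  subquotient_iso ZU BU ZW BW.
Proof.
move=> [r [l z lr rl]] [r' [l' z' lr' rl']].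
exists (fun u w => exists2 v, r u v & r' v w); split.
- move=> a u u' w w' [v ? ?] [v' ? ?].
  by exists (a *: v + v'); [apply: l|apply: l'].
- by move=> u w [v /z[? ? BB] /z'[? ? BB']]; split=> //; apply: (iff_trans BB).
- by move=> u /lr[v uv]; have [_ /lr'[w vw] _] := z _ _ uv; exists w, v.
- by move=> w /rl'[v vw]; have [/rl[u uv] _ _] := z' _ _ vw; exists u, v.
Qed.

End SubquotientIso.

(** * Cochains as functions of finite sequences *)

Section SeqCochains.
Variables (R : comNzRingType) (V : lmodType R) (T : Type).
Implicit Types (f g : seq T -> V) (s : seq T) (A : set T) (k : nat).

(* The Alexander-Spanier differential on functions of finite sequences, all degrees at
   once: expanding along the first vertex, (df)(x, s) = f(s) - d(f(x, .))(s). *)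
Fixpoint seqd f s {struct s} : V :=
  if s is x :: s' then f s' - seqd (fun l => f (x :: l)) s' else 0.

Lemma seqd_is_linear : linear seqd.
Proof.
move=> a f g; apply/funext => s. rewrite !fctE.
elim: s f g => [|x s IH] f g /=; first by rewrite scaler0 addr0.
rewrite (IH (fun l => f (x :: l)) (fun l => g (x :: l))).
by rewrite scalerBr opprD addrACA.
Qed.

HB.instance Definition _ := GRing.isLinear.Build R
  (seq T -> V) (seq T -> V) _ seqd seqd_is_linear.

Lemma seqdBE f g s : seqd (fun l => f l - g l) s = seqd f s - seqd g s.
Proof. exact: (congr1 (fun h => h s) (linearB seqd f g)). Qed.

Lemma seqdKE f s : seqd (seqd f) s = 0.
Proof.
elim: s f => [//|x s IH] f /=.
by rewrite (seqdBE f (seqd (fun l => f (x :: l)))) IH subr0 subrr.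
Qed.

Lemma seqdK f : seqd (seqd f) = 0.
Proof. by apply/funext => s; rewrite seqdKE. Qed.

Fixpoint all_in A s : Prop := if s is x :: s' then A x /\ all_in A s' else True.

Lemma all_inS A B s : A `<=` B -> all_in A s -> all_in B s.
Proof. by move=> AB; elim: s => //= x s IH [/AB ? /IH]. Qed.

Definition vanish k A f := forall s, size s = k -> all_in A s -> f s = 0.

Lemma vanishS k A B f : B `<=` A -> vanish k A f -> vanish k B f.
Proof. by move=> BA fA s sk /(all_inS BA); exact: fA. Qed.

Lemma vanish_linear k A a f g :
  vanish k A f -> vanish k A g -> vanish k A (a *: f + g).
Proof. by move=> fA gA s sk sA; rewrite !fctE fA// gA// scaler0 addr0. Qed.

Lemma vanish_seqd k A f : vanish k A f -> vanish k.+1 A (seqd f).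
Proof.
move=> fA s; elim: s k f fA => [//|x s IH] k f fA /= [sk] [Ax sA].
rewrite fA// sub0r; case: s IH sk sA => [|y s] IH sk sA; first by rewrite /= oppr0.
case: k sk fA => // k [sk] fA; rewrite (IH k) ?oppr0//= ?sk// => l lk lA.
by apply: fA => //=; rewrite lk.
Qed.

End SeqCochains.

(** * Prism operators *)

Section Prism.
Variables (R : comNzRingType) (V : lmodType R) (S T : Type) (a b : S -> T).
Implicit Types (f g : seq T -> V) (s : seq S).

Definition pullback (h : S -> T) f s : V := f (map h s).

Lemma seqd_pullbackE (h : S -> T) f s : seqd (pullback h f) s = seqd f (map h s).
Proof. by elim: s f => [//|x s IH] f /=; rewrite -(IH (fun l => f (h x :: l))). Qed.

Lemma seqd_pullback (h : S -> T) f : seqd (pullback h f) = pullback h (seqd f).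
Proof. by apply/funext => s; rewrite seqd_pullbackE. Qed.

(* The homotopy between pullback a and pullback b: the alternating sum of the
   f(a x_1, .., a x_i, b x_i, .., b x_k). *)
Fixpoint prism f s {struct s} : V :=
  if s is x :: s' then
    f (a x :: b x :: map b s') - prism (fun l => f (a x :: l)) s'
  else 0.

Lemma prism_is_linear : linear prism.
Proof.
move=> c f g; apply/funext => s; rewrite !fctE.
elim: s f g => [|x s IH] f g /=; first by rewrite scaler0 addr0.
rewrite (IH (fun l => f (a x :: l)) (fun l => g (a x :: l))).
by rewrite scalerBr opprD addrACA.
Qed.

HB.instance Definition _ := GRing.isLinear.Build R
  (seq T -> V) (seq S -> V) _ prism prism_is_linear.

Lemma prismBE f g s : prism (fun l => f l - g l) s = prism f s - prism g s.
Proof. exact: (congr1 (fun h => h s) (linearB prism f g)). Qed.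

(** Both terms on the right are expanded along the first vertex: the contributions of [fab] and
    [prism f s] cancel, and the induction hypothesis for [fa] supplies the rest. *)
Lemma prismE f s :
  f (map b s) - f (map a s) = seqd (prism f) s + prism (seqd f) s.
Proof.
elim: s f => [|x s IH] f /=; first by rewrite subrr addr0.
pose fa l := f (a x :: l); pose fab l := fa (b x :: l).
rewrite (seqdBE (pullback b fab) (prism fa)) (prismBE f (seqd fa)).
rewrite seqd_pullbackE -/fa -/fab.
have -> : prism (seqd fa) s = fa (map b s) - fa (map a s) - seqd (prism fa) s.
  by rewrite IH addrC addKr.
rewrite -/(fa (map a s)) -/(fa (map b s)) -/(fab _).
move: (prism f s) (seqd fab _) (seqd (prism fa) s) => p q r.
move: (fa _) (fa _) (f _) => u v w.
rewrite !opprB !addrA subrK (addrAC (p + r)) subrK (addrAC p) (addrAC (p + w)).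
by rewrite addrK (addrC p) (addrAC w) addrK.
Qed.

Lemma vanish_prism k A B f : (forall x, A x -> B (a x)) ->
  (forall x, A x -> B (b x)) -> vanish k.+1 B f -> vanish k A (prism f).
Proof.
move=> aB bB fB s; elim: s k f fB => [//|x s IH] k f fB /= [sk] [Ax sA].
rewrite fB/= ?size_map ?sk//; last first.
  split; [exact: aB|split; first exact: bB].
  by elim: s {IH sk} sA => //= y s IH [Ay /IH]; split; first exact: bB.
case: k sk fB => // k [sk] fB; rewrite sub0r (IH k) ?oppr0// => l lk lB.
by apply: fB => //=; rewrite ?lk//; split=> //; exact: aB.
Qed.

End Prism.

Lemma all_in_map (S T : Type) (h : S -> T) (A : set T) s :
  all_in A (map h s) <-> all_in (h @^-1` A) s.
Proof. by elim: s => //= x s IH; rewrite IH. Qed.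

(** * Germs of cochains *)

Section VanishNear.
Variables (R : comNzRingType) (V : lmodType R).

(* The germ of f on k-tuples is zero at t; for k = 0 this says that f [::] = 0,
   whatever t is. *)
Definition vanish_near (T : topologicalType) k (f : seq T -> V) (t : T) :=
  exists2 A, nbhs t A & vanish k A f.

Variables (T : topologicalType).
Implicit Types (f g : seq T -> V) (t : T).

Lemma vanish_nearT k f t : vanish k setT f -> vanish_near k f t.
Proof. by move=> fT; exists setT => //; exact: filterT. Qed.

Lemma vanish_near0 f t : vanish_near 0 f t <-> f [::] = 0.
Proof.
split=> [[A _ /(_ [::])]|f0]; first exact.
by apply: vanish_nearT => -[].
Qed.

Lemma vanish_near_linear k a f g t :
  vanish_near k f t -> vanish_near k g t -> vanish_near k (a *: f + g) t.
Proof.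
move=> [A tA fA] [B tB gB]; exists (A `&` B); first exact: filterI.
by apply: vanish_linear; [apply: vanishS fA|apply: vanishS gB] => x [].
Qed.

Lemma vanish_near_zero k t : vanish_near k (0 : seq T -> V) t.
Proof. exact: vanish_nearT. Qed.

Lemma vanish_nearD k f g t :
  vanish_near k f t -> vanish_near k g t -> vanish_near k (f + g) t.
Proof. by move=> /(vanish_near_linear 1); rewrite scale1r; apply. Qed.

Lemma vanish_nearN k f t : vanish_near k f t -> vanish_near k (- f) t.
Proof.
move=> /(vanish_near_linear (-1)) /(_ (vanish_near_zero _ _)).
by rewrite scaleN1r addr0.
Qed.

Lemma vanish_nearB k f g t :
  vanish_near k f t -> vanish_near k g t -> vanish_near k (f - g) t.
Proof. by move=> ? /vanish_nearN; apply: vanish_nearD. Qed.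

Lemma vanish_near_seqd k f t : vanish_near k f t -> vanish_near k.+1 (seqd f) t.
Proof. by move=> [A tA fA]; exists A => //; exact: vanish_seqd. Qed.

Lemma vanish_near_open k f t :
  vanish_near k f t -> \forall t' \near t, vanish_near k f t'.
Proof.
move=> [A tA fA]; near=> t'; exists A => //.
by near: t'; rewrite near_nbhs; exact: nbhs_interior.
Unshelve. all: by end_near. Qed.

End VanishNear.

(** * Homotopy invariance *)

Section Homotopy.
Variables (K : realType) (R : comNzRingType) (V : lmodType R).
Variables (Y W : topologicalType) (h : Y -> K -> W).

(* Continuity on Y * [0, 1] only: the values of h at other times are arbitrary. *)
Definition unit_continuous := forall y t, 0 <= t <= 1 -> forall B, nbhs (h y t) B ->
  exists2 U, nbhs y U & exists2 e : K, 0 < e &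
    forall y' t', U y' -> 0 <= t' <= 1 -> `|t' - t| < e -> B (h y' t').

Hypothesis hc : unit_continuous.

(** A Lebesgue number in the time direction: by compactness one [e] serves all of [A] times
    [[0, 1]], whereas [U] and [B] depend on the point. *)
Lemma homotopy_mesh k (f : seq W -> V) (A : set Y) : compact A ->
  (forall y t, A y -> 0 <= t <= 1 -> vanish_near k f (h y t)) ->
  exists2 e : K, 0 < e & forall y t, A y -> 0 <= t <= 1 ->
    exists2 U, nbhs y U & exists2 B, vanish k B f &
      forall y' t', U y' -> 0 <= t' <= 1 -> `|t' - t| < e -> B (h y' t').
Proof.
move=> Ac fA.
pose P (e : K) (yt : Y * K) := exists2 U, nbhs yt.1 U & exists2 B, vanish k B f &
  forall y' t', U y' -> 0 <= t' <= 1 -> `|t' - yt.2| < e -> B (h y' t').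
have : \forall e \near 0^'+, A `*` `[0, 1]%classic `<=` P e.
  apply: (iffLR (compact_near_coveringP _)
    (compact_setX Ac (@segment_compact K 0 1)) _ _ P) => // -[y t] [/= Ay].
  rewrite in_itv/= => t01.
  have [B hB fB] := fA _ _ Ay t01.
  have [U yU [e e0 UB]] := hc t01 hB.
  exists ([set yt | nbhs yt.1 U /\ `|yt.2 - t| < e / 2], [set e' | e' < e / 2]).
    split; last by apply: nbhs_right_lt; rewrite divr_gt0.
    exists (U°, [set t' | `|t' - t| < e / 2]) => /=.
      split; first exact: nbhs_interior.
      exists (e / 2) => /=; first by rewrite divr_gt0.
      by move=> t' /=; rewrite distrC.
    by move=> [y' t'] [/= ? ?]; split.
  move=> [[y' t'] e'] [/= [Uy' t't] e'e]; exists U => //; exists B => //.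
  move=> y2 t2 Uy2 t201 t2t'; apply: UB => //.
  rewrite (_ : t2 - t = (t2 - t') + (t' - t)); last by rewrite addrA subrK.
  by rewrite (le_lt_trans (ler_normD _ _))// (splitr e) ltrD// (lt_trans t2t').
move=> -[e/= e0 eP].
have AP : `[< A `*` `[0, 1]%classic `<=` P (e / 2) >].
  apply/asboolP/eP; rewrite /= ?divr_gt0// sub0r normrN gtr0_norm ?divr_gt0//.
  by rewrite ltr_pdivrMr// ltr_pMr// ltr1n.
exists (e / 2); first by rewrite divr_gt0.
move=> y t Ay t01; have /asboolP/(_ (y, t)) := AP; apply; split => //=.
Qed.

(* By compactness, [0, 1] can be cut into N steps short enough for d f to vanish on the
   N prisms over small tuples near A. *)
Lemma homotopy_invariance k (f : seq W -> V) (A : set Y) : compact A ->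
  (forall y t, A y -> 0 <= t <= 1 -> vanish_near k.+1 (seqd f) (h y t)) ->
  exists g, forall y, A y ->
    vanish_near k (pullback (h^~ 1) f - pullback (h^~ 0) f - seqd g) y.
Proof.
move=> Ac fA; have [e e0 eP] := homotopy_mesh Ac fA.
(* More than 1/e steps, so that consecutive times are less than [e] apart. *)
pose N := (Num.bound e^-1).+1.
have Ne : N%:R^-1 < e.
  rewrite invf_plt ?posrE//.
  rewrite (lt_trans (archi_boundP _)) ?invr_ge0 ?(ltW e0)// ltr_nat//.
pose a j y := h y (j%:R / N%:R).
exists (\sum_(0 <= j < N) prism (a j) (a j.+1) f) => y Ay.
have -> : pullback (h^~ 1) f - pullback (h^~ 0) f =
    \sum_(0 <= j < N) (pullback (a j.+1) f - pullback (a j) f).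
  rewrite (telescope_sumr (fun j => pullback (a j) f))// /a mul0r.
  by rewrite divff ?pnatr_eq0.
rewrite linear_sum -sumrB big_seq.
apply: (big_ind (fun g => vanish_near k g y)) => [|? ?|j].
- exact: vanish_near_zero.
- exact: vanish_nearD.
rewrite mem_index_iota => /andP[_ jN].
have -> : pullback (a j.+1) f - pullback (a j) f - seqd (prism (a j) (a j.+1) f)
    = prism (a j) (a j.+1) (seqd f).
  by apply/funext => s; rewrite !fctE /pullback prismE addrC addKr.
have j01 i : (i <= N)%N -> 0 <= (i%:R / N%:R : K) <= 1.
  by move=> iN; rewrite divr_ge0//= ler_pdivrMr// mul1r ler_nat.
have [U yU [B fB UB]] := eP y (j%:R / N%:R) Ay (j01 _ (ltnW jN)).
exists U => //; apply: vanish_prism fB => x Ux.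
  by apply: UB => //; [exact/j01/ltnW|rewrite subrr normr0].
apply: UB => //; first exact: j01.
by rewrite -mulrBl -natrB// subSnn mul1r ger0_norm ?invr_ge0.
Qed.

(** At time 1 every tuple becomes (w, .., w), where the cone [fw'] is a primitive because [seqd f]
    vanishes at w; the homotopy carries this back to time 0. *)
Lemma homotopy_acyclic k (f : seq W -> V) (A : set Y) w : compact A ->
  (forall y, h y 1 = w) ->
  vanish_near k.+1 (seqd f) w ->
  (forall y t, A y -> 0 <= t <= 1 -> vanish_near k.+1 (seqd f) (h y t)) ->
  exists g, forall y, A y -> vanish_near k (pullback (h^~ 0) f - seqd g) y.
Proof.
move=> Ac h1 fw fA; have [g gP] := homotopy_invariance Ac fA.
pose fw' l := f (w :: l).
exists (pullback (h^~ 1) fw' - g) => y Ay.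
rewrite linearB (subr_detour _ (pullback (h^~ 1) f)).
apply: vanish_nearB; last exact: gP.
apply: vanish_nearT => s sk _; rewrite !fctE /= seqd_pullbackE /pullback.
have -> : map (h^~ 1) s = nseq k w.
  by rewrite -sk; elim: s {sk} => //= x s ->; rewrite h1.
have [B wB /(_ (nseq k.+1 w))] := fw; rewrite size_nseq; apply=> //.
by elim: k.+1 => //= n; split => //; exact: nbhs_singleton.
Qed.

End Homotopy.

Lemma within_unit_continuous (K : realType) (Y W : topologicalType) (H : Y * K -> W) :
  {within [set: Y] `*` `[0, 1]%classic, continuous H} ->
  unit_continuous (fun y t => H (y, t)).
Proof.
move=> /subspace_continuousP Hc y t t01 B hB.
have yt : ([set: Y] `*` `[0, 1]%classic) (y, t) by split => //=; rewrite in_itv.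
have [[U T] /= [yU [e/= e0 tT]] UT] := Hc _ yt _ hB.
exists U => //; exists e => // y' t' Uy' t'01 t't; apply: (UT (y', t')).
  by split => //; apply: tT; rewrite /= distrC.
by split => //=; rewrite in_itv.
Qed.

Lemma unit_continuous_bounded (K : realType) (Y : topologicalType) (X : metricType K)
    (h : Y -> K -> X) (A : set Y) (x : X) : unit_continuous h -> compact A ->
  exists n : nat, forall y t, A y -> 0 <= t <= 1 -> mdist x (h y t) <= n%:R.
Proof.
move=> hc Ac.
pose P (n : nat) (yt : Y * K) := 0 <= yt.2 <= 1 -> mdist x (h yt.1 yt.2) <= n%:R.
have : \forall n \near \oo, A `*` `[0, 1]%classic `<=` P n.
  apply: (iffLR (compact_near_coveringP _)
    (compact_setX Ac (@segment_compact K 0 1)) _ _ P) => // -[y t] [/= Ay].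
  rewrite in_itv/= => t01.
  have [U yU [e e0 UB]] := hc _ _ t01 _ (nbhsx_ballx (h y t) 1 ltr01).
  pose N := Num.bound (mdist x (h y t) + 1).
  exists (U `*` [set t' | `|t' - t| < e], [set n | (N <= n)%N]).
    split; last by exists N.
    exists (U, [set t' | `|t' - t| < e]) => //=; split=> //.
    by exists e => //= t' /=; rewrite distrC.
  move=> [[y' t'] n] [/= [Uy' t't] Nn] /= t'01.
  have := UB _ _ Uy' t'01 t't; rewrite ballEmdist /= => /ltW d1.
  rewrite (le_trans (metric_triangle _ (h y t) _))//.
  rewrite (@le_trans _ _ (mdist x (h y t) + 1)) ?lerD2l//.
  rewrite (@le_trans _ _ N%:R) ?ler_nat// ltW// archi_boundP//.
  by rewrite addr_ge0 ?mdist_ge0.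
move=> [n _ nP]; exists n => y t Ay t01.
by apply: (nP n _ (y, t)) => //=; split=> //=; rewrite in_itv.
Qed.

Lemma nbhs_mdist (K : realType) (X : metricType K) (x : X) (A : set X) :
  nbhs x A <-> exists2 e : K, 0 < e & forall y, mdist x y < e -> A y.
Proof.
split=> [/nbhs_ballP[e /= e0 eA]|[e e0 eA]].
  by exists e => // y xy; apply: eA; rewrite ballEmdist.
by apply/nbhs_ballP; exists e => // y; rewrite ballEmdist => /eA.
Qed.

(** * Uniform acyclicity of balls *)

Section UniformContraction.
Variables (K : realType) (X : metricType K).
Hypotheses (Xproper : proper_metric X) (Xcocompact : cocompact X).
Hypothesis Xcontr : contractible K X.

Definition contraction_to (h : X -> K -> X) w :=
  [/\ unit_continuous h, forall x, h x 0 = x & forall x, h x 1 = w].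

(** One contraction of X is conjugated by an isometry [g] with [g x0] within r of [c]. Isometries
    preserve distances, so [S] does not depend on [c]; replacing [c] by [g x0] costs r on either
    side. *)
Lemma uniform_contraction : exists S : nat -> nat, forall c : X,
  exists h w, contraction_to h w /\ forall (n : nat) x t,
    mdist c x <= n%:R -> 0 <= t <= 1 -> mdist c (h x t) <= (S n)%:R.
Proof.
have [x0 [r [r0 cov]]] := Xcocompact.
have [w [H [/within_unit_continuous Hc H0 H1]]] := Xcontr.
have S' (n : nat) : {m : nat | forall y t, mdist x0 y <= n%:R + r -> 0 <= t <= 1 ->
    mdist x0 (H (y, t)) <= m%:R}.
  apply: cid; have [m mP] := unit_continuous_bounded x0 Hc (@Xproper x0 (n%:R + r)).
  by exists m => y t; exact: mP.
exists (fun n => (sval (S' n) + Num.bound r)%N) => c.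
have [g [[g' gK g'K] giso]] := cov c; rewrite /cball/= => gc.
have g'iso x y : mdist (g' x) (g' y) = mdist x y by rewrite -giso !g'K.
exists (fun x t => g (H (g' x, t))), (g w); split; first split.
- move=> x t t01 B; move=> /nbhs_mdist[e e0 eB].
  have /= := Hc (g' x) t t01 (ball (H (g' x, t)) e) (nbhsx_ballx _ _ e0).
  move=> [U xU [d d0 UB]].
  exists (g' @^-1` U).
    move: xU => /nbhs_mdist[e' e'0 e'U]; apply/nbhs_mdist; exists e' => //.
    by move=> y /= xy; apply: e'U; rewrite /= g'iso.
  exists d => // y' t' Uy' t'01 t't; apply: eB => /=; rewrite giso.
  by have := UB _ _ Uy' t'01 t't; rewrite ballEmdist.
- by move=> x; rewrite H0 g'K.
- by move=> x; rewrite H1.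
- move=> n x t cx t01; rewrite (le_trans (metric_triangle _ (g x0) _))// addnC natrD.
  rewrite lerD//.
    by rewrite metric_sym (le_trans gc)// ltW// archi_boundP// ltW.
  rewrite giso; apply: (svalP (S' n)) => //.
  rewrite -giso g'K (le_trans (metric_triangle _ c _))// addrC lerD//.
Qed.

End UniformContraction.

Section BallAcyclic.
Variables (K : realType) (X : metricType K) (R : comNzRingType) (V : lmodType R).
Variables (c : X) (S : nat -> nat).
Hypothesis Xproper : proper_metric X.
Hypothesis contrS : exists h w, contraction_to h w /\ forall (n : nat) x (t : K),
    mdist c x <= n%:R -> 0 <= t <= 1 -> mdist c (h x t) <= (S n)%:R.
Implicit Types (f g : seq X -> V).

Let vanish_ball n k f := forall x, mdist c x <= n%:R -> vanish_near k f x.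

Lemma ball_acyclic n k f : vanish_ball (S n) k.+1 (seqd f) ->
  exists g, vanish_ball n k (f - seqd g).
Proof.
move=> fS; have [h [w [[hc h0 h1] hS]]] := contrS.
have [|x t cx t01|g gP] := homotopy_acyclic hc (@Xproper c n%:R) h1 (f := f) (k := k).
- by rewrite -(h1 c); apply/fS/hS; rewrite ?mdistxx ?ler01 ?lexx.
- exact/fS/hS.
exists g => x cx; have -> : f = pullback (h^~ 0) f; last exact: gP.
by apply/funext => s; rewrite /pullback (eq_map h0) map_id.
Qed.


Lemma vanish_ballS m n k f : (m <= n)%N -> vanish_ball n k f -> vanish_ball m k f.
Proof. by move=> mn fn x cx; apply: fn; rewrite (le_trans cx)// ler_nat. Qed.

(** Iterates of [S], made strictly increasing so that the balls exhaust X; a cocycle on one ball has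
    a primitive on the previous one. *)
Fixpoint radius j : nat :=
  if j is i.+1 then maxn (S (radius i)) (radius i).+1 else 0.

Lemma radius_ge j : (j <= radius j)%N.
Proof. by elim: j => //= j IH; rewrite leq_max orbC ltnS IH. Qed.

Lemma radius_homo i j : (i <= j)%N -> (radius i <= radius j)%N.
Proof.
apply: (homo_leq (r := leq)) => //; [exact: leq_trans|].
by move=> {}i /=; rewrite leq_max leqnSn orbT.
Qed.

(* If dg and dg' agree on a large ball, then g' can be changed by a coboundary so as to
   agree with g on a smaller ball. *)
Lemma fill_step j k f g : (forall x, vanish_near k.+2 (seqd f) x) ->
  vanish_ball (radius j) k.+1 (f - seqd g) ->
  exists g', vanish_ball (radius j.+1) k.+1 (f - seqd g') /\
    forall i, j = i.+1 -> vanish_ball (radius i) k (g' - g).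
Proof.
move=> df fg; have [g1 g1P] := @ball_acyclic (radius j.+1) k.+1 f (fun x _ => df x).
case: j fg g1P => [|i] fg g1P; first by exists g1; split.
have [x cx|z zP] := @ball_acyclic (radius i) k (g1 - g).
  have cx' : mdist c x <= (radius i.+1)%:R.
    by rewrite (le_trans cx)// ler_nat leq_maxl.
  have -> : seqd (g1 - g) = (f - seqd g) - (f - seqd g1).
    by rewrite linearB opprB [RHS]addrCA (addrAC f) subrr add0r.
  apply: vanish_nearB; first exact: fg.
  by apply: g1P; rewrite (le_trans cx')// ler_nat radius_homo.
exists (g1 - seqd z); split=> [x cx|_ [<-] x cx]; last by rewrite addrAC; exact: zP.
by rewrite linearB /= seqdK subr0; exact: g1P.
Qed.

(** In degree 0 a cocycle is constant: any ball around [c] carries a primitive, that is a constant,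
    and its value is read off at [c]. *)
Lemma fill_vertices f : (forall x, vanish_near 2 (seqd f) x) ->
  exists g, (forall x, vanish_near 1 (f - seqd g) x) /\
    forall n, vanish_ball (radius n.+1) 1 f -> vanish_ball n 0 g.
Proof.
move=> df; exists (fun=> f [:: c]); split=> [x|n fn x _]; last first.
  apply/vanish_near0; have [|A cA /(_ [:: c] erefl)] := fn c; first by rewrite mdistxx.
  by apply; split => //; exact: nbhs_singleton.
have [g gP] := @ball_acyclic (Num.bound (mdist c x)) 1 f (fun x _ => df x).
have bx : mdist c x <= (Num.bound (mdist c x))%:R.
  by rewrite ltW// archi_boundP// mdist_ge0.
have [|A cA /(_ [:: c] erefl)] := gP c; first by rewrite mdistxx.
rewrite !fctE /= subr0 => /(_ (conj (nbhs_singleton cA) I))/eqP.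
rewrite subr_eq0 => /eqP fc; have [B xB gB] := gP x bx.
exists B => // -[|y [|? ?]]// _ [By _]; have := gB [:: y] erefl (conj By I).
by rewrite !fctE /= !subr0 fc.
Qed.

(* The primitive is the limit of primitives on larger and larger balls, corrected so as
   to stabilise. To control where it vanishes, the sequence starts with 0 on the largest
   ball on which f vanishes. The limit is taken tuplewise, by choosing the term of the
   sequence according to the distance from c to the first vertex. *)
Lemma fill_edges k f : (forall x, vanish_near k.+3 (seqd f) x) ->
  exists g, (forall x, vanish_near k.+2 (f - seqd g) x) /\
    forall n, vanish_ball (radius n.+1) k.+2 f -> vanish_ball n k.+1 g.
Proof.
move=> df.
have [fall|] := pselect (forall m, vanish_ball (radius m) k.+2 f).
  exists 0; split=> [x|n _ x _]; last exact: vanish_near_zero.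
  rewrite linear0 subr0; apply: (fall (Num.bound (mdist c x))).
  rewrite (@le_trans _ _ (Num.bound (mdist c x))%:R) ?ler_nat ?radius_ge//.
  by rewrite ltW// archi_boundP// mdist_ge0.
move=> /existsNP[m0 m0P].
have [j0 [u0 [u0P u00]]] : exists j0 u0, vanish_ball (radius j0) k.+2 (f - seqd u0) /\
    forall n, vanish_ball (radius n.+1) k.+2 f -> u0 = 0 /\ (n < j0)%N.
  have [m /asboolP mP mmin] :=
    ex_minnP (ex_intro (fun m => `[< ~ vanish_ball (radius m) k.+2 f >]) m0 (asboolT m0P)).
  have lt_m n : vanish_ball (radius n) k.+2 f -> (n < m)%N.
    move=> fn; rewrite ltnNge; apply/negP => mn; apply: mP.
    by apply: vanish_ballS fn; exact: radius_homo.
  (* If [f] vanishes on none of the balls, any primitive on the smallest one is a valid start. *)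
  case: m mP mmin lt_m => [|m] mP mmin lt_m.
    have [g gP] := @ball_acyclic (radius 0) k.+2 f (fun x _ => df x).
    by exists 0%N, g; split=> // n /lt_m.
  exists m, 0; rewrite linear0 subr0; split=> [|n /lt_m nm]; last by split.
  by apply: contrapT => /asboolT/mmin; rewrite ltnn.
have nextE (p : nat * (seq X -> V)) : exists g',
    vanish_ball (radius p.1) k.+2 (f - seqd p.2) ->
    vanish_ball (radius p.1.+1) k.+2 (f - seqd g') /\
    forall i, p.1 = i.+1 -> vanish_ball (radius i) k.+1 (g' - p.2).
  have [/(fill_step df)[g' g'P]|nP] :=
    pselect (vanish_ball (radius p.1) k.+2 (f - seqd p.2)).
    by exists g'.
  by exists 0.
have [next nextP] := choice nextE.
pose u := fix u i := if i is i'.+1 then next ((j0 + i')%N, u i') else u0.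
have uP i : vanish_ball (radius (j0 + i)) k.+2 (f - seqd (u i)).
  elim: i => [|i /(nextP (_, _))[]]; first by rewrite addn0.
  by rewrite /= addnS.
have uS i j : (j0 + i)%N = j.+1 -> vanish_ball (radius j) k.+1 (u i.+1 - u i).
  by move=> ij; apply: (nextP (_, _) (uP i)).2.
(* As germs on the ball of radius i, the sequence is stationary from term i + 1 on. *)
have chain t i d : mdist c t <= i%:R -> vanish_near k.+1 (u (i + d).+1 - u i.+1) t.
  move=> ct; elim: d => [|d IH].
    by rewrite addn0 subrr; exact: vanish_near_zero.
  rewrite -(subrK (u (i + d).+1) (u _)) -addrA; apply: vanish_nearD => //.
  rewrite addnS; apply: (uS _ (j0 + (i + d))%N); rewrite ?addnS//.
  rewrite (le_trans ct)// ler_nat (leq_trans _ (radius_ge _))//.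
  by rewrite addnA addnAC leq_addl.
(* The 1 leaves room: any t within 1 of y lies in the ball of radius [lev y], where [chain]
   applies. *)
have levE y : exists m : nat, mdist c y + 1 <= m%:R /\
    forall n : nat, mdist c y + 1 <= n%:R -> (m <= n)%N.
  have ex : exists n : nat, mdist c y + 1 <= n%:R.
    exists (Num.bound (mdist c y + 1)).
    by rewrite ltW// archi_boundP// addr_ge0 ?mdist_ge0.
  by case: (ex_minnP ex) => n; exists n.
have [lev levP] := choice levE.
pose g s := u (lev (head c s)).+1 s.
have loc t : exists2 n : nat, mdist c t <= n%:R & vanish_near k.+1 (g - u n.+1) t.
  (* One unit for the ball around t and one for the margin in [lev]: then [lev y <= n] for y near t,
     so only finitely many terms occur there. *)
  pose n := Num.bound (mdist c t + 2).
  have tn : mdist c t + 2 <= n%:R by rewrite ltW// archi_boundP// addr_ge0 ?mdist_ge0.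
  have ctn : mdist c t <= n%:R by rewrite (le_trans _ tn)// lerDl.
  exists n => //.
  have AE (i : 'I_n.+1) : exists A, nbhs t A /\
      (mdist c t <= i%:R -> vanish k.+1 A (u n.+1 - u i.+1)).
    have [ti|ti] := pselect (mdist c t <= i%:R); last first.
      by exists setT; split=> //; exact: filterT.
    have [] := chain t i (n - i)%N ti; rewrite subnKC -1?ltnS ?ltn_ord// => A tA Av.
    by exists A.
  have [A AP] := choice AE.
  exists (ball t 1 `&` [set y | forall i, A i y]).
    apply: filterI; first exact: nbhsx_ballx.
    by apply: filter_forall => i; exact: (AP i).1.
  move=> [|y s]//= [sk] [[ty Ay] sA]; rewrite !fctE /g /=.
  move: ty; rewrite ballEmdist /= => /ltW ty.
  have yn : (lev y < n.+1)%N.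
    rewrite ltnS; apply: (levP y).2; rewrite (le_trans _ tn)//.
    by rewrite -[2]/(1 + 1) addrA lerD2r (le_trans (metric_triangle _ t _))// lerD2l.
  have ty' : mdist c t <= (lev y)%:R.
    rewrite (le_trans _ (levP y).1)// (le_trans (metric_triangle _ y _))// lerD2l//.
    by rewrite metric_sym.
  have /(_ (y :: s)) := (AP (Ordinal yn)).2 ty'.
  rewrite !fctE /= sk => /(_ erefl) gu; apply/eqP; rewrite -oppr_eq0 opprB gu//.
  by split=> //; apply: all_inS sA => z [].
exists g; split=> [t|n fn t tn].
  have [n tn gt] := loc t.
  rewrite -(subrK (u n.+1) g) linearD /= opprD addrCA.
  apply: vanish_nearD; first by apply/vanish_nearN/vanish_near_seqd.
  apply: (uP n.+1 t); rewrite (le_trans tn)// ler_nat (leq_trans _ (radius_ge _))//.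
  by rewrite addnS ltnW// ltnS leq_addl.
(* The sequence starts at 0 and, as [n < j0], all its corrections vanish on the ball of radius n. *)
have [u0E nj0] := u00 n fn.
have [m tm gt] := loc t; rewrite -(subrK (u m.+1) g).
apply: vanish_nearD => //.
elim: {tm gt} m.+1 => [|i IH]; first by rewrite /= u0E; exact: vanish_near_zero.
rewrite -(subrK (u i) (u i.+1)); apply: vanish_nearD => //.
apply: (uS i (j0.-1 + i)%N); first by rewrite -addSn (ltn_predK nj0).
rewrite (le_trans tn)// ler_nat (leq_trans _ (radius_ge _))//.
by rewrite (@leq_trans j0.-1) ?leq_addr// -ltnS (ltn_predK nj0).
Qed.

(* n |-> radius n.+1 does not depend on f: this uniformity is what makes the columns of
   the double complex below exact. *)
Lemma fill k f : (forall x, vanish_near k.+2 (seqd f) x) ->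
  exists g, (forall x, vanish_near k.+1 (f - seqd g) x) /\
    forall n, vanish_ball (radius n.+1) k.+1 f -> vanish_ball n k g.
Proof. by case: k => [|k]; [exact: fill_vertices|exact: fill_edges]. Qed.

End BallAcyclic.

(** * The double complex *)

Section SeqdExtra.
Variables (R : comNzRingType) (T : Type).

Lemma seqd_comp (V W : lmodType R) (L : {linear V -> W}) (f : seq T -> V) s :
  seqd (fun l => L (f l)) s = L (seqd f s).
Proof.
elim: s f => [|x s IH] f /=; first by rewrite linear0.
by rewrite (IH (fun l => f (x :: l))) linearB.
Qed.

Lemma seqd_eval (S : Type) (V : lmodType R) (f : seq T -> S -> V) s y :
  seqd f s y = seqd (fun l => f l y) s.
Proof. by elim: s f => //= x s IH f; rewrite -(IH (fun l => f (x :: l))). Qed.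

End SeqdExtra.

Lemma finite_filterI (T I : Type) (A : set I) (F : set_system T) (f : I -> set T) :
  Filter F -> finite_set A -> (forall i, A i -> F (f i)) ->
  F [set t | forall i, A i -> f i t].
Proof.
move=> FF /finite_setP[n]; elim: n A => [|n IH] A.
  rewrite II0 card_eq0 => /eqP-> _; apply: filterS filterT => t _ i [].
move=> /eq_cardSP[i Ai /IH nA] fA.
have : F (f i `&` [set t | forall j, (A `\ i) j -> f j t]).
  by apply: filterI; [exact: fA|apply: nA => j [Aj _]; exact: fA].
apply: filterS => t [fi fj] j Aj; have [<-//|ij] := pselect (i = j).
by apply: fj; split=> // ji; apply: ij.
Qed.

Section DoubleComplex.
Variables (K : realType) (G : groupType) (X : metricType K) (R : comNzRingType).
Variables (o : G -> X) (c : X -> G) (R0 : K).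
(* o is the orbit map g |-> psi g x0, and c a coarse inverse of it. *)
Hypothesis o_finite : forall y r, finite_set [set g | mdist (o g) y <= r].
Hypothesis o_mull : forall r, exists2 E, finite_set E &
  forall h g, mdist (o h) (o g) <= r -> exists2 e, E e & g = (h * e)%g.
Hypothesis o_mulr : forall a, exists k, forall h, mdist (o (h * a)%g) (o h) <= k.
Hypothesis c_near : forall y, mdist (o (c y)) y <= R0.
Hypothesis X_fill : exists S : nat -> nat, forall (b : X) k (f : seq X -> R^o),
  (forall x, vanish_near k.+2 (seqd f) x) ->
  exists g, (forall x, vanish_near k.+1 (f - seqd g) x) /\
    forall n, (forall x, mdist b x <= (S n)%:R -> vanish_near k.+1 f x) ->
      forall x, mdist b x <= n%:R -> vanish_near k g x.

Implicit Types (p q : nat) (phi psi : seq G -> seq X -> R^o) (h : G) (x : seq G).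

Definition meets q r h (f : seq X -> R^o) :=
  exists2 t, mdist (o h) t <= r & ~ vanish_near q f t.

(* For q = 0 this is the finiteness of h |-> phi (h x), that is, the condition that
   h |-> phi (h^-1 x) lies in the group ring; for p = 0 it says that phi [::] has bounded
   support. There are no cochains for p = q = 0. *)
Definition bi_cochain p q phi :=
  (forall x, size x = p -> forall r,
     finite_set [set h | meets q r h (phi [seq (h * g)%g | g <- x])]) /\
  (p = 0 -> q = 0 -> phi [::] [::] = 0).

Definition bi_null p q phi :=
  forall x, size x = p -> forall t, vanish_near q (phi x) t.

Definition dX phi x := seqd (phi x).

Lemma dX_is_linear : linear dX.
Proof. by move=> a f g; apply/funext => x; rewrite /dX !fctE linearP. Qed.

HB.instance Definition _ := GRing.isLinear.Build R
  (seq G -> seq X -> R^o) (seq G -> seq X -> R^o) _ dX dX_is_linear.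

Lemma dXK phi : dX (dX phi) = 0.
Proof. by apply/funext => x; rewrite /dX seqdK. Qed.

Lemma seqd_dX phi : seqd (dX phi) = dX (seqd phi).
Proof. by apply/funext => x; rewrite /dX; exact: (seqd_comp (@seqd R R^o X) phi). Qed.

Lemma meets_linear q r h a f g :
  meets q r h (a *: f + g) -> meets q r h f \/ meets q r h g.
Proof.
move=> [t ht nfg]; apply: contrapT => /not_orP[nf ng]; apply: nfg.
apply: vanish_near_linear; apply: contrapT => n.
  by apply: nf; exists t.
by apply: ng; exists t.
Qed.

Lemma bi_cochain_linear p q a phi psi : bi_cochain p q phi -> bi_cochain p q psi ->
  bi_cochain p q (a *: phi + psi).
Proof.
move=> [fP f0] [gP g0]; split=> [x xp r|p0 q0]; last first.
  by rewrite !fctE f0// g0// scaler0 addr0.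
apply: (@sub_finite_set _ _ ([set h | meets q r h (phi [seq (h * g)%g | g <- x])] `|`
   [set h | meets q r h (psi [seq (h * g)%g | g <- x])])).
  by move=> h /meets_linear.
by rewrite finite_setU; split; [exact: fP|exact: gP].
Qed.

Lemma bi_null_linear p q a phi psi : bi_null p q phi -> bi_null p q psi ->
  bi_null p q (a *: phi + psi).
Proof. by move=> fP gP x xp t; apply: vanish_near_linear; [exact: fP|exact: gP]. Qed.

Lemma bi_nullD p q phi psi : bi_null p q phi -> bi_null p q psi -> bi_null p q (phi + psi).
Proof. by move=> fP gP x xp t; apply: vanish_nearD; [exact: fP|exact: gP]. Qed.

Lemma bi_nullB p q phi psi : bi_null p q phi -> bi_null p q psi -> bi_null p q (phi - psi).
Proof. by move=> fP gP x xp t; apply: vanish_nearB; [exact: fP|exact: gP]. Qed.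

Lemma bi_nullN p q phi : bi_null p q phi -> bi_null p q (- phi).
Proof. by move=> fP x xp t; apply: vanish_nearN; exact: fP. Qed.

Lemma bi_cochain0 p q : bi_cochain p q 0.
Proof.
split=> // x _ r; rewrite (_ : [set _ | _] = set0)//.
by apply/seteqP; split=> // h [t _]; apply; exact: vanish_near_zero.
Qed.

Lemma bi_cochainB p q phi psi : bi_cochain p q phi -> bi_cochain p q psi ->
  bi_cochain p q (phi - psi).
Proof. by move=> fP gP; rewrite -scaleN1r addrC; exact: bi_cochain_linear. Qed.

Lemma bi_null_dX p q phi : bi_null p q phi -> bi_null p q.+1 (dX phi).
Proof. by move=> fP x xp t; apply: vanish_near_seqd; exact: fP. Qed.

Lemma bi_null_seqd p q phi : bi_null p q phi -> bi_null p.+1 q (seqd phi).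
Proof.
move=> fP x; elim: x p phi fP => [//|g x IH] p phi fP [xp] t /=.
apply: vanish_nearB; first exact: fP.
case: p xp fP => [/size0nil->|p xp fP]; first by move=> _; exact: vanish_near_zero.
by apply: (IH p) => // l lp t'; apply: fP; rewrite /= lp.
Qed.

Lemma bi_cochain_dX p q phi : bi_cochain p q phi -> bi_cochain p q.+1 (dX phi).
Proof.
move=> [fP _]; split=> // x xp r; apply: sub_finite_set (fP x xp r) => h [t ht nf].
by exists t => // /vanish_near_seqd.
Qed.

Lemma bi_cochain_seqd p q phi : bi_cochain p q phi -> bi_cochain p.+1 q (seqd phi).
Proof.
move=> [fP _]; split=> // x xp r.
(* The function is allowed to depend on h, since freezing the first vertex [h * g] in the induction
   introduces such a dependence. *)
suff: forall (Phi : G -> seq G -> seq X -> R^o),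
    (forall x', (size x').+1 = size x ->
      finite_set [set h | meets q r h (Phi h [seq (h * g)%g | g <- x'])]) ->
    finite_set [set h | meets q r h (seqd (Phi h) [seq (h * g)%g | g <- x])].
  by apply=> x'; rewrite xp => -[xp']; exact: fP.
elim: x {xp} => [|g x IH] Phi PhiP /=.
  rewrite (_ : [set _ | _] = set0)//; apply/seteqP; split=> // h [t _]; apply.
  exact: vanish_near_zero.
apply: (@sub_finite_set _ _
  ([set h | meets q r h (seqd (fun l => Phi h ((h * g)%g :: l)) [seq (h * g)%g | g <- x])] `|`
   [set h | meets q r h (Phi h [seq (h * g)%g | g <- x])])).
  by move=> h; rewrite /= -scaleN1r addrC => /meets_linear.
rewrite finite_setU; split; last exact: PhiP.
apply: (IH (fun h l => Phi h ((h * g)%g :: l))) => x' xx'.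
by apply: (PhiP (g :: x')); rewrite /= xx'.
Qed.

Definition in_prevG p q psi := if p is p'.+1 then bi_cochain p' q psi else psi = 0.
Definition in_prevX p q psi := if q is q'.+1 then bi_cochain p q' psi else psi = 0.

(* Contraction: prepend to x a group element whose orbit point is near y_1. It is local
   since, for y_1 near a given point, only finitely many group elements occur. *)
Lemma row_exact p q phi : bi_cochain p q.+1 phi -> bi_null p.+1 q.+1 (seqd phi) ->
  exists2 psi, in_prevG p q.+1 psi & bi_null p q.+1 (phi - seqd psi).
Proof.
move=> phiD dphi.
pose psi x (y : seq X) := if y is y1 :: _ then phi (c y1 :: x) y else 0.
have psiN : bi_null p q.+1 (phi - seqd psi).
  move=> x xp t.
  have /choice[A AP] g : exists B, nbhs t B /\ vanish q.+1 B (seqd phi (g :: x)).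
    by have [|B tB Bv] := dphi (g :: x) _ t; [rewrite /= xp|exists B].
  (* For a first point y in the unit ball around t, [c y] is one of the finitely many g with orbit
     point within [R0 + 1] of t. *)
  exists (ball t 1 `&` [set y | forall g, mdist (o g) t <= R0 + 1 -> A g y]).
    apply: filterI; first exact: nbhsx_ballx.
    exact: (finite_filterI _ (o_finite t (R0 + 1)) (fun g _ => (AP g).1)).
  move=> [|y s]//= [sq] [[ty Ay] sA]; rewrite !fctE.
  have -> : phi x (y :: s) - seqd psi x (y :: s) = seqd phi (c y :: x) (y :: s).
    by rewrite /= !fctE !seqd_eval.
  apply: (AP (c y)).2; first by rewrite /= sq.
  have cy : mdist (o (c y)) t <= R0 + 1.
    rewrite (le_trans (metric_triangle _ y _))// lerD//.
    by move: ty; rewrite ballEmdist /= metric_sym => /ltW.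
  by split; [exact: Ay|apply: all_inS sA => z [_ /(_ _ cy)]].
(* For p = 0 the only tuple is empty and [seqd psi] is 0 there, so [psiN] already says that [phi] is
   null. *)
case: p phiD dphi psiN => [|p] phiD dphi psiN.
  exists 0 => // x x0 t; have := psiN x x0 t.
  by rewrite !fctE linear0 (size0nil x0).
exists psi => //; split=> // x xp r.
(* At points within r of [o h], the prepended elements have orbit points within [r + (R0 + 1)] of
   [o h], so they are [h * e] with e in a finite set independent of h. *)
have [E Efin EP] := o_mull (r + (R0 + 1)).
apply: (@sub_finite_set _ _ (\bigcup_(e in E)
  [set h | meets q.+1 r h (phi [seq (h * g)%g | g <- e :: x])])); last first.
  by apply: bigcup_finite => // e Ee; apply: phiD.1; rewrite /= xp.
move=> h [t ht npsi]; apply: contrapT => nh; apply: npsi.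
pose hx := [seq (h * g)%g | g <- x].
have /choice[A AP] g : exists B, nbhs t B /\
    (mdist (o g) t <= R0 + 1 -> vanish q.+1 B (phi (g :: hx))).
  have [gt|gt] := pselect (mdist (o g) t <= R0 + 1); last first.
    by exists setT; split=> //; exact: filterT.
  have [|e Ee ge] := EP h g.
    by rewrite (le_trans (metric_triangle _ t _))// lerD// metric_sym.
  apply: contrapT => nB; apply: nh; exists e => //; exists t => //= -[B tB Bv].
  by apply: nB; exists B; rewrite ge.
exists (ball t 1 `&` [set y | forall g, mdist (o g) t <= R0 + 1 -> A g y]).
  apply: filterI; first exact: nbhsx_ballx.
  exact: (finite_filterI _ (o_finite t (R0 + 1)) (fun g _ => (AP g).1)).
move=> [|y s]//= [sq] [[ty Ay] sA]; rewrite /psi -/hx.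
have cy : mdist (o (c y)) t <= R0 + 1.
  rewrite (le_trans (metric_triangle _ y _))// lerD//.
  by move: ty; rewrite ballEmdist /= metric_sym => /ltW.
apply: (AP (c y)).2 => //=; first by rewrite sq.
by split; [exact: Ay|apply: all_inS sA => z [_ /(_ _ cy)]].
Qed.

(** Each [phi x] is filled in X around the orbit point of the first vertex of x. For the translates
    of x by h this centre stays within bounded distance of [o h], and the radii in [X_fill] do not
    depend on the centre, so the finiteness condition survives. *)
Lemma column_exact p q phi : bi_cochain p.+1 q phi -> bi_null p.+1 q.+1 (dX phi) ->
  exists2 psi, in_prevX p.+1 q psi & bi_null p.+1 q (phi - dX psi).
Proof.
case: q => [|q] phiD dphi.
  (* From q = 0, [dX] produces a constant function of one point, and a constant vanishing near a
     point is 0. *)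
  exists 0 => // x xp t; rewrite linear0 subr0; apply/vanish_near0.
  have [A tA /(_ [:: t] erefl)] := dphi x xp t.
  by rewrite /dX/= subr0; apply; split=> //; exact: nbhs_singleton.
have [S SP] := X_fill.
have /choice[psi psiP] x : exists g,
    (forall t, vanish_near q.+2 (dX phi x) t) ->
    (forall t, vanish_near q.+1 (phi x - seqd g) t) /\
    forall n, (forall t, mdist (o (head 1%g x)) t <= (S n)%:R ->
        vanish_near q.+1 (phi x) t) ->
      forall t, mdist (o (head 1%g x)) t <= n%:R -> vanish_near q g t.
  have [/(SP (o (head 1%g x)))[g gP]|nd] :=
    pselect (forall t, vanish_near q.+2 (dX phi x) t); first by exists g.
  by exists 0.
exists psi; last by move=> x xp t; apply: (psiP x _).1 => t'; exact: dphi.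
split=> // -[//|a x] [xp] r; have [k kP] := o_mulr a.
(* For every h, the ball of radius n around [o (h * a)] contains the one of radius r around
   [o h]. *)
pose n := Num.bound (`|k| + `|r|).
apply: sub_finite_set (phiD.1 (a :: x) _ ((S n)%:R + k)) => [h [t ht npsi]|]; last first.
  by rewrite /= xp.
apply: contrapT => nh; apply: npsi.
apply: ((psiP _ _).2 n) => [t'|t' ht'|]; first by apply: dphi; rewrite /= size_map xp.
  apply: contrapT => nphi; apply: nh; exists t' => //.
  rewrite (le_trans (metric_triangle _ (o (h * a)%g) _))// addrC lerD//.
  by rewrite metric_sym kP.
rewrite /= (le_trans (metric_triangle _ (o h) _))//.
rewrite (@le_trans _ _ (`|k| + `|r|))// ?lerD ?(le_trans _ (ler_norm _))//.
by rewrite ltW// archi_boundP// addr_ge0.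
Qed.

(* With D^{p,q} the bi_cochains, ker (dG dX) / (im dG + im dX) in bidegree (p, q). On the
   edges q = 0 and p = 0 this is the cohomology of the corresponding edge complex, and
   it only depends on p + q. *)
Definition bi_cocycle p q : set (seq G -> seq X -> R^o) :=
  [set phi | bi_cochain p q phi /\ bi_null p.+1 q.+1 (seqd (dX phi))].

Definition bi_boundary p q : set (seq G -> seq X -> R^o) :=
  [set phi | exists u v, [/\ in_prevG p q u, in_prevX p q v &
                             bi_null p q (phi - seqd u - dX v)]].

Lemma bi_cocycle_linear p q a phi psi : bi_cocycle p q phi -> bi_cocycle p q psi ->
  bi_cocycle p q (a *: phi + psi).
Proof.
move=> [fD fZ] [gD gZ]; split; first exact: bi_cochain_linear.
by rewrite !linearP; exact: bi_null_linear.
Qed.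

(** A diagram chase: [phi] and [psi] correspond when their images in bidegree (p+1, q+1) agree. Row
    exactness produces [psi] from [phi], column exactness [phi] from [psi], and the same two facts
    transfer boundaries. *)
Lemma bi_step p q : subquotient_iso (bi_cocycle p.+1 q) (bi_boundary p.+1 q)
  (bi_cocycle p q.+1) (bi_boundary p q.+1).
Proof.
exists (fun phi psi => [/\ bi_cocycle p.+1 q phi, bi_cocycle p q.+1 psi &
  bi_null p.+1 q.+1 (dX phi - seqd psi)]); split.
- move=> a f f' g g' [[fD fZ] [gD gZ] fg] [[f'D f'Z] [g'D g'Z] f'g']; split.
  + exact: bi_cocycle_linear.
  + exact: bi_cocycle_linear.
  + rewrite !linearP /= addrACA -scalerDr; exact: bi_null_linear.
- move=> f g [fZ gZ fg]; split=> //; split=> [[u [v [uD vD uv]]]|[u [v [uD vD uv]]]].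
  + have guN : bi_null p.+1 q.+1 (seqd (g - dX u)).
      have -> : seqd (g - dX u) = dX (f - seqd u - dX v) - (dX f - seqd g).
        rewrite (linearB (@seqd _ _ _)) !(linearB dX) /= dXK seqd_dX subr0 opprB.
        by rewrite [RHS]addrC addrA subrK.
      exact: bi_nullB (bi_null_dX uv) fg.
    have [|w wD wP] := row_exact _ guN.
      by apply: bi_cochainB; [exact: gZ.1|exact: bi_cochain_dX].
    by exists w, u; split=> //; rewrite addrAC.
  + have fvN : bi_null p.+1 q.+1 (dX (f - seqd v)).
      have -> : dX (f - seqd v) = seqd (g - seqd u - dX v) + (dX f - seqd g).
        rewrite (linearB dX) !(linearB (@seqd _ _ _)) /= seqdK seqd_dX subr0.
        by rewrite [RHS]addrC addrA subrK.
      exact: bi_nullD (bi_null_seqd uv) fg.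
    have [|w wD wP] := column_exact _ fvN.
      by apply: bi_cochainB; [exact: fZ.1|exact: bi_cochain_seqd].
    by exists v, w; split.
- move=> f [fD fZ]; have [g gD gP] := row_exact (bi_cochain_dX fD) fZ.
  exists g; split=> //; split=> //; rewrite seqd_dX.
  have := bi_nullN (bi_null_dX gP).
  by rewrite (linearB dX) /= dXK sub0r opprK.
- move=> g [gD gZ]; rewrite seqd_dX in gZ.
  have [f fD fP] := column_exact (bi_cochain_seqd gD) gZ.
  have fgN : bi_null p.+1 q.+1 (dX f - seqd g).
    by have := bi_nullN fP; rewrite opprB.
  exists f; split=> //; last by split=> //; rewrite seqd_dX.
  split=> //; have := bi_nullN (bi_null_seqd fP).
  by rewrite (linearB (@seqd _ _ _)) /= seqdK sub0r opprK.
Qed.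

Lemma bi_staircase p q :
  subquotient_iso (bi_cocycle (p + q) 0) (bi_boundary (p + q) 0)
    (bi_cocycle p q) (bi_boundary p q).
Proof.
elim: q p => [|q IH] p; last first.
  by rewrite -addSnnS; apply: subquotient_iso_trans (IH _) _; exact: bi_step.
rewrite addn0; exists (fun phi psi => bi_cocycle p 0 phi /\ phi = psi); split.
- move=> a f f' g g' [fZ <-] [f'Z <-]; split=> //; exact: bi_cocycle_linear.
- by move=> f g [fZ <-].
- by move=> f; exists f.
- by move=> f; exists f.
Qed.

End DoubleComplex.

(** * The boundary *)

Section SubtypeTopology.
Variables (T : topologicalType) (A : set T).

Lemma nbhs_set_type (z : set_type A) (B : set (set_type A)) :
  nbhs z B <-> exists2 C, nbhs (val z) C & forall z', C (val z') -> B z'.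
Proof.
split=> [[_ /= [[U oU <-] Uz UB]]|[C]].
  by exists U; [exact: open_nbhs_nbhs|move=> z' Uz'; apply: UB; rewrite /= set_valE].
rewrite nbhsE => -[U [oU Uz] UC] CB; exists (set_val @^-1` U); split.
- by exists U.
- by rewrite /= set_valE.
- by move=> z' /= Uz'; apply/CB/UC; rewrite -set_valE.
Qed.

End SubtypeTopology.

Lemma metrizable_hausdorff (K : realType) (T : topologicalType) :
  metrizable K T -> hausdorff_space T.
Proof.
move=> [d [d0 dC dT dN]] p q pq; apply/d0; apply: contrapT => npq.
have dge x y : 0 <= d x y.
  by have := dT x y x; rewrite (dC y x) (iffRL (d0 x x) erefl) -mulr2n pmulrn_lge0.
have dpq : 0 < d p q / 2 by rewrite divr_gt0// lt_neqAle dge andbT eq_sym; exact/eqP.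
have nb x : nbhs x [set y | d x y < d p q / 2] by apply/dN; exists (d p q / 2).
have [x [/= px qx]] := pq _ _ (nb p) (nb q).
have := dT p x q; rewrite (dC x q) leNgt => /negP; apply.
by rewrite [ltRHS]splitr ltrD.
Qed.

Section NearRetraction.
Variables (K : realType) (T : topologicalType) (A : set T).
Hypotheses (Tmetr : metrizable K T) (Aclosed : closed A).

(* Sending each point to a nearly closest point of A is continuous at the points of A. *)
Lemma near_retraction (a0 : set_type A) : exists p : T -> set_type A,
  (forall a, p (val a) = a) /\
  forall (a : set_type A) B, nbhs a B -> \forall x \near val a, B (p x).
Proof.
have [d [d0 dC dT dN]] := Tmetr.
have dge x y : 0 <= d x y.
  by have := dT x y x; rewrite (dC y x) (iffRL (d0 x x) erefl) -mulr2n pmulrn_lge0.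
have /choice[p pP] x : exists a : set_type A,
    forall a' : set_type A, d x (val a) <= 2 * d x (val a').
  have [Ax|nAx] := pselect (A x).
    exists (exist _ x (mem_set Ax)) => a' /=.
    by rewrite (iffRL (d0 x x) erefl) mulr_ge0.
  have [e e0 eA] : exists2 e : K, 0 < e & forall a, A a -> e <= d x a.
    have /dN[e e0 eA] : nbhs x (~` A).
      by apply: open_nbhs_nbhs; split=> //; exact: closed_openC.
    by exists e => // a Aa; rewrite leNgt; apply/negP => /eA.
  pose S := [set d x a | a in A].
  have Sinf : has_inf S.
    split; first by exists (d x (val a0)), (val a0) => //; exact: set_mem (valP a0).
    by exists e => _ [a Aa <-]; exact: eA.
  have Se : e <= inf S by apply: lb_le_inf Sinf.1 _ => _ [a Aa <-]; exact: eA.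
  have [_ [a Aa <-] ainf] := inf_adherent (lt_le_trans e0 Se) Sinf.
  exists (exist _ a (mem_set Aa)) => a'; rewrite (le_trans (ltW ainf))//.
  have : inf S <= d x (val a').
    apply: ge_inf; first exact: Sinf.2.
    by exists (val a') => //; exact: set_mem (valP a').
  by lra.
exists p; split=> [a|a B /nbhs_set_type[C /dN[e e0 eC] CB]].
  apply/val_inj/esym/d0; apply/eqP; rewrite eq_le dge andbT.
  by rewrite (le_trans (pP _ a))// (iffRL (d0 _ _) erefl) mulr0.
apply/dN; exists (e / 3); first by rewrite divr_gt0.
move=> x /= ax; apply/CB/eC => /=; rewrite (le_lt_trans (dT _ x _))//.
rewrite (le_lt_trans (lerD (lexx _) (pP x a)))// (dC x).
by move: ax; lra.
Qed.

End NearRetraction.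

Section GermsAtSubspace.
Variables (K : realType) (T : topologicalType) (A : set T) (R : comNzRingType).
Hypotheses (Tmetr : metrizable K T) (Aclosed : closed A).
Let incl (a : set_type A) : T := val a.
Implicit Types (F : seq T -> R^o) (f : seq (set_type A) -> R^o).

(* Germs along A of functions on tuples of T, as opposed to functions on tuples of A. For
   k = 0 there are no germs to take and the function has to vanish, even if A is empty. *)
Definition null_at k F := (k = 0 -> F [::] = 0) /\
  forall a : set_type A, vanish_near k F (val a).
Definition germ_cocycle k : set (seq T -> R^o) :=
  [set F | forall a : set_type A, vanish_near k.+1 (seqd F) (val a)].
Definition germ_coboundary k : set (seq T -> R^o) :=
  [set F | exists E, null_at k (F - seqd E)].

Definition AS_cocycle (S : topologicalType) k : set (seq S -> R^o) :=
  [set f | forall z, vanish_near k.+1 (seqd f) z].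
Definition AS_coboundary (S : topologicalType) k : set (seq S -> R^o) :=
  [set f | exists e, (k = 0 -> f [::] = 0) /\ forall z, vanish_near k (f - seqd e) z].

Lemma vanish_near_val k F (a : set_type A) :
  vanish_near k F (val a) -> vanish_near k (pullback incl F) a.
Proof.
move=> [B aB FB]; exists (incl @^-1` B); first by apply/nbhs_set_type; exists B.
move=> s sk sB; rewrite /pullback FB ?size_map//; exact/all_in_map.
Qed.

(* Tautness of A: a near retraction p extends functions on A to functions on T, and the
   prism between p and the identity is local at the points of A. *)
Lemma taut k : subquotient_iso (germ_cocycle k) (germ_coboundary k)
  (@AS_cocycle (set_type A) k) (@AS_coboundary (set_type A) k).
Proof.
exists (fun F f => [/\ germ_cocycle k F, AS_cocycle k f, k = 0 -> F [::] = f [::] &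
  forall a, vanish_near k (pullback incl F - f) a]); split.
- move=> c F F' f f' [FZ fZ F0 Ff] [F'Z f'Z F'0 F'f']; split.
  + by move=> a; rewrite linearP; exact: vanish_near_linear.
  + by move=> a; rewrite linearP; exact: vanish_near_linear.
  + by move=> k0; rewrite !fctE F0// F'0.
  + move=> a; have -> : pullback incl (c *: F + F') - (c *: f + f') =
        c *: (pullback incl F - f) + (pullback incl F' - f').
      by rewrite scalerBr addrACA -opprD.
    exact: vanish_near_linear.
- move=> F f [FZ fZ F0 Ff]; split=> //; split=> [[E [E0 EP]]|[e [e0 eP]]].
    exists (pullback incl E); split=> [k0|a].
      by rewrite -F0// -(E0 k0) !fctE /= subr0.
    have -> : f - seqd (pullback incl E) =
        pullback incl (F - seqd E) - (pullback incl F - f).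
      by rewrite seqd_pullback opprB addrCA; congr (f + _); rewrite addrAC subrr add0r.
    by apply: vanish_nearB => //; exact: vanish_near_val.
  (* Over an empty [A] the germ conditions hold trivially, and only the value at the empty tuple
     remains to be checked. *)
  have [[z Az]|A0] := pselect (A !=set0); last first.
    exists 0; split=> [k0|a].
      by rewrite linear0 subr0 F0// e0.
    by case: A0; exists (val a); exact: set_mem (valP a).
  have [p [pA pB]] := near_retraction Tmetr Aclosed (exist _ z (mem_set Az)).
  pose q x : T := val (p x); pose P := prism id q F.
  (* Near [A], [F] differs by the coboundary of the prism from its composite with [q], which is the
     extension along [p] of the restriction of [F]; that restriction agrees with [f], hence with
     [seqd e]. *)
  exists (pullback p e - P); split=> [k0|a].
    by rewrite !fctE /= subr0 F0// e0.
  have -> : F - seqd (pullback p e - P) =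
      pullback p ((pullback incl F - f) + (f - seqd e)) - prism id q (seqd F).
    rewrite linearB /= seqd_pullback; apply/funext => s; rewrite !fctE.
    have := prismE id q F s; rewrite -/P map_id => E.
    have -> : prism id q (seqd F) s = F (map q s) - F s - seqd P s by rewrite E addrC addKr.
    rewrite /pullback subrKA -map_comp; exact: subr_detour.
  apply: vanish_nearB; last first.
    have [B aB FB] := FZ a; exists (B `&` [set x | B (q x)]).
      apply: filterI => //; apply: (pB a (fun z => B (val z))).
      by apply/nbhs_set_type; exists B.
    by apply: vanish_prism FB => x [].
  have [B aB vB] := vanish_nearD (Ff a) (eP a).
  exists [set x | B (p x)]; first exact: pB.
  move=> s sk sB; rewrite /pullback vB ?size_map//; exact/all_in_map.
- move=> F FZ; exists (pullback incl F); split=> // a; last first.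
    by rewrite subrr; exact: vanish_near_zero.
  by rewrite seqd_pullback; exact: vanish_near_val.
- move=> f fZ; have [[z Az]|A0] := pselect (A !=set0); last first.
    exists (fun=> f [::]); split=> // a;
      by case: A0; exists (val a); exact: set_mem (valP a).
  have [p [pA pB]] := near_retraction Tmetr Aclosed (exist _ z (mem_set Az)).
  exists (pullback p f); split=> // a.
    have [B aB fB] := fZ a; exists [set x | B (p x)]; first exact: pB.
    by move=> s sk sB; rewrite seqd_pullback /pullback fB ?size_map//; exact/all_in_map.
  have -> : pullback incl (pullback p f) = f.
    apply/funext => s; rewrite /pullback -map_comp.
    by rewrite (eq_map (g := id)) ?map_id// => x /=; rewrite pA.
  by rewrite subrr; exact: vanish_near_zero.
Qed.

End GermsAtSubspace.

(** * Cochains with bounded support *)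

Section BoundedSupport.
Variables (K : realType) (X : metricType K) (R : comNzRingType) (x0 : X).
Implicit Types (f b : seq X -> R^o).

Definition bounded_support k f :=
  exists n : nat, forall t, n%:R < mdist x0 t -> vanish_near k f t.
(** Index k means functions of k + 1 points, one more than in [germ_cocycle k]: this absorbs the
    degree shift of the transgression. *)
Definition bounded_cocycle k : set (seq X -> R^o) :=
  [set b | bounded_support k.+1 b /\ forall t, vanish_near k.+2 (seqd b) t].
(** On a bounded X the support condition says nothing, so for k = 0 the vanishing of [e] at the
    empty tuple is imposed separately. *)
Definition bounded_coboundary k : set (seq X -> R^o) :=
  [set b | exists e, [/\ bounded_support k e, k = 0 -> e [::] = 0 &
                         forall t, vanish_near k.+1 (b - seqd e) t]].

End BoundedSupport.

Section BoundedSupportDouble.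
Variables (K : realType) (G : groupType) (X : metricType K) (R : comNzRingType).
Variables (o : G -> X) (c : X -> G) (R0 : K) (x0 : X).
Hypothesis o_finite : forall y r, finite_set [set g | mdist (o g) y <= r].
Hypothesis c_near : forall y, mdist (o (c y)) y <= R0.

(** Every point is within [R0] of the orbit, and a ball contains only finitely many orbit points,
    counted with multiplicity. *)
Lemma bounded_supportP k (f : seq X -> R^o) :
  (forall r, finite_set [set h | meets o k r h f]) <-> bounded_support x0 k f.
Proof.
split=> [fin|[n nP] r]; last first.
  apply: sub_finite_set (o_finite x0 (n%:R + r)) => h [t ht nf] /=.
  rewrite (le_trans (metric_triangle _ t _))// [leLHS]addrC lerD//.
  by rewrite metric_sym leNgt; apply/negP => /nP.
have [n _ nP] : \forall n \near \oo, forall h, meets o k R0 h f ->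
    mdist x0 (o h) + R0 <= n%:R.
  apply: (@finite_filterI _ _ [set h | meets o k R0 h f] \oo
    (fun h => [set n : nat | mdist x0 (o h) + R0 <= n%:R])) => // h _.
  exists (Num.bound `|mdist x0 (o h) + R0|) => // m /= hm.
  rewrite (le_trans (ler_norm _))// (le_trans (ltW (archi_boundP _)))// ler_nat//.
exists n => t nt; apply: contrapT => nf; move: nt; apply/negP; rewrite -leNgt.
rewrite (le_trans (metric_triangle _ (o (c t)) _))//.
rewrite (le_trans _ (nP n _ (c t) _)) ?lerD//=.
by exists t => //; exact: c_near.
Qed.

(** For p = 0 a cochain is its value at the empty tuple of G, and [seqd] sends it to the constant
    function of one group element, so nothing is lost in the cocycle condition. *)
Lemma bi_bounded_iso k : subquotient_iso
  (bi_cocycle (R := R) o 0 k.+1) (bi_boundary o 0 k.+1)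
  (bounded_cocycle x0 k) (bounded_coboundary x0 k).
Proof.
have ZE (phi : seq G -> seq X -> R^o) :
    bi_cocycle o 0 k.+1 phi <-> bounded_cocycle x0 k (phi [::]).
  split=> [[[phiP _] dphi]|[phiB dphi]]; split.
  - by apply/bounded_supportP => r; have := phiP [::] erefl r.
  - move=> t; have := dphi [:: 1%g] erefl t; rewrite /= subr0; exact.
  - by split=> // x /size0nil-> r; exact: (iffRL (bounded_supportP _ _) phiB).
  - by move=> [|g [|? ?]]// _ t; rewrite /= subr0; exact: dphi.
have bE (e : seq X -> R^o) : [/\ bounded_support x0 k e & k = 0 -> e [::] = 0] ->
    bi_cochain o 0 k (fun=> e).
  move=> [eB e0]; split=> // x _ r; exact: (iffRL (bounded_supportP _ _) eB).
exists (fun phi b => bi_cocycle o 0 k.+1 phi /\ phi [::] = b).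
split=> [a f f' _ _ [fZ <-] [f'Z <-]|f _ [fZ <-]|f fZ|b bZ].
- by split=> //; exact: bi_cocycle_linear.
- split=> //; first exact: (iffLR (ZE _) fZ).
  split=> [[u [v [uE [vD v0] fv]]]|[e [eB e0 ef]]].
    exists (v [::]); split=> [|k0|t]; [|exact: v0|].
      by apply/bounded_supportP => r; have := vD [::] erefl r.
    by have := fv [::] erefl t; rewrite uE linear0 subr0.
  exists 0, (fun=> e); split=> //; first exact: bE.
  by move=> x /size0nil-> t; rewrite linear0 subr0; exact: ef.
- by exists (f [::]).
- by exists (fun=> b); split=> //; apply/ZE.
Qed.

End BoundedSupportDouble.

(** * From bounded supports to germs along the boundary *)

Section Compactification.
Variables (K : realType) (X : metricType K) (Xbar : topologicalType) (i : X -> Xbar).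
Variables (R : comNzRingType) (x0 : X).
Hypotheses (Xproper : proper_metric X) (Xcontr : contractible K X).
Hypotheses (icomp : compactification i) (Zset : is_Zset K (boundary i)).
Let Z := boundary i.
Implicit Types (F E : seq Xbar -> R^o) (b e : seq X -> R^o).

Let Xbar_compact : compact [set: Xbar]. Proof. by case: icomp. Qed.
Let i_inj : injective i. Proof. by case: icomp => _ _ []. Qed.
Let i_cont : continuous i. Proof. by case: icomp => _ _ []. Qed.

Let Xbar_hausdorff : hausdorff_space Xbar.
Proof. by case: icomp => _ [_] /metrizable_hausdorff. Qed.

Let open_range : open (range i).
Proof. by rewrite -(setCK (range i)); apply: closed_openC; case: Zset. Qed.

Let nbhs_image (t : X) (A : set X) : nbhs t A -> nbhs (i t) (i @` A).
Proof.
rewrite (@nbhsE X t) => -[U [oU Ut] UA]; case: icomp => _ _ [_ _ /(_ U oU)[V oV UV]] _.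
have : nbhs (i t) (V `&` range i).
  apply: open_nbhs_nbhs; split; first exact: openI.
  split; last by exists t.
  by have := Ut; rewrite UV.
by apply: filterS => y [Vy [x _ xy]]; exists x => //; apply: UA; rewrite UV /= xy.
Qed.

Let vanish_near_i k F (t : X) : vanish_near k F (i t) <-> vanish_near k (pullback i F) t.
Proof.
split=> [[A tA FA]|[A tA FA]].
  exists (i @^-1` A); first exact: i_cont.
  by move=> s sk sA; rewrite /pullback FA ?size_map//; exact/all_in_map.
exists (i @` A); first exact: nbhs_image.
move=> s sk sA; have [s' s'A sE] : exists2 s', all_in A s' & s = map i s'.
  elim: s {sk} sA => [|y s IH] /=; first by exists [::].
  by move=> [[x Ax <-] /IH[s' s'A ->]]; exists (x :: s').
by rewrite sE -/(pullback i F s') FA// -sk sE size_map.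
Qed.

Let boundaryVimage y : Z y \/ exists t, y = i t.
Proof. by have [[t _ <-]|] := pselect (range i y); [right; exists t|left]. Qed.

Let vanish_everywhere k F : (forall y, Z y -> vanish_near k F y) ->
  (forall t, vanish_near k (pullback i F) t) -> forall y, vanish_near k F y.
Proof.
by move=> FZ FX y; have [/FZ//|[t ->]] := boundaryVimage y; exact/vanish_near_i.
Qed.

(* Bounded support only says that b vanishes on small tuples far out, and tuples close
   to the boundary of the compactification are not small in X. The truncation of b to
   tuples whose first vertex lies in a large ball differs from b by a locally zero
   function and does extend by zero. *)
Lemma bounded_support_extend k b : bounded_support x0 k b -> (k = 0 -> b [::] = 0) ->
  exists F, [/\ forall y, Z y -> vanish_near k F y, k = 0 -> F [::] = 0 &
                forall t, vanish_near k (pullback i F - b) t].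
Proof.
case: k => [|k] [n nP] b0.
  exists 0; split=> // [y _|t]; first exact: vanish_near_zero.
  by apply/vanish_near0; rewrite !fctE /= b0// subrr.
have /choice[j jK] y : exists t, range i y -> i t = y.
  by have [[t _ <-]|ny] := pselect (range i y); [exists t|exists x0 => /ny].
(* Points not in the open ball of radius n + 1 are strictly farther than n, where [b] vanishes. *)
pose B := cball x0 (n%:R + 1).
pose F (s : seq Xbar) : R^o := if `[< all_in (i @` B) (take 1 s) /\ all_in (range i) s >]
  then b (map j s) else 0.
exists F; split=> // [y Zy|t].
  exists (~` (i @` B)).
    apply: open_nbhs_nbhs; split; last by move=> [t _ ty]; apply: Zy; exists t.
    apply: closed_openC; apply: compact_closed => //.
    apply: continuous_compact; last exact: Xproper.
    by apply: continuous_subspaceT.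
  by move=> [|y1 s]//= _ [ny1 _]; rewrite /F; case: asboolP => //= -[[]].
have rangei s : all_in (range i) (map i s) by elim: s => //= x s IH; split=> //; exists x.
have jiK s : map j (map i s) = s.
  rewrite -map_comp -[RHS]map_id; apply: eq_map => x /=.
  by apply: i_inj; apply: jK; exists x.
have [tB|tB] := ltP (mdist x0 t) (n%:R + 1).
  exists (ball t (n%:R + 1 - mdist x0 t)); first by apply: nbhsx_ballx; rewrite subr_gt0.
  move=> [|x s]//= _ [tx _]; rewrite !fctE /pullback /F asboolT ?jiK ?subrr//.
  split; last exact: (rangei (x :: s)).
  rewrite /= take0; split=> //; exists x => //; rewrite /B /cball /=.
  move: tx; rewrite ballEmdist /= ltrBrDl => /ltW; apply: le_trans.
  exact: metric_triangle.
have [|A tA bA] := nP t; first by rewrite (lt_le_trans _ tB)// ltrDl.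
exists A => // s sk sA; rewrite !fctE bA// subr0 /pullback /F.
by case: ifP => // _; rewrite jiK bA.
Qed.

(** Germs vanish on an open neighbourhood of [Z]; what is left of the compact [Xbar] is covered by
    finitely many images of unit balls of X. *)
Lemma bounded_support_restrict k F : (forall y, Z y -> vanish_near k F y) ->
  bounded_support x0 k (pullback i F).
Proof.
move=> FZ; pose P (n : nat) y :=
  forall t, y = i t -> ~ vanish_near k F y -> mdist x0 t <= n%:R.
have [n _ nP] : \forall n \near \oo, [set: Xbar] `<=` P n.
  apply: (iffLR (compact_near_coveringP _) Xbar_compact) => y _.
  have [/FZ/vanish_near_open Fy|[t ->]] := boundaryVimage y.
    exists ([set y' | vanish_near k F y'], setT); first by split=> //; exact: filterT.
    by move=> [y' n] [/= Fy' _] t _.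
  exists (i @` ball t 1, [set n | (Num.bound (mdist x0 t + 1) <= n)%N]).
    by split; [apply: nbhs_image; exact: nbhsx_ballx|exists (Num.bound (mdist x0 t + 1))].
  move=> [_ n] [/= [x tx <-] tn] x' /i_inj <- _.
  rewrite (le_trans (metric_triangle _ t _))//.
  rewrite (@le_trans _ _ (mdist x0 t + 1))// ?lerD2l.
    by move: tx; rewrite ballEmdist /= => /ltW.
  rewrite (le_trans (ltW (archi_boundP _))) ?addr_ge0 ?mdist_ge0// ler_nat//.
exists n => t nt; apply/vanish_near_i; apply: contrapT => nF.
by move: nt; apply/negP; rewrite -leNgt; apply: (nP n _ (i t)) => //=.
Qed.

(* The homotopy of the Z-set pushes Xbar into X, which is contractible. *)
Lemma compactification_acyclic k F : (forall y, vanish_near k.+1 (seqd F) y) ->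
  exists E, forall y, vanish_near k (F - seqd E) y.
Proof.
move=> dF; have [_ [H [/within_unit_continuous Hc H0 HZ]]] := Zset.
have [w [C [/within_unit_continuous Cc C0 C1]]] := Xcontr.
have [g1 g1P] := homotopy_invariance Hc Xbar_compact (f := F) (k := k) (fun _ _ _ _ => dF _).
(* [r] is the end of the push, read in X. Its continuity comes from [i] being an open embedding. *)
have /choice[r rP] y : exists t, i t = H (y, 1).
  have /HZ : 0 < (1 : K) <= 1 by rewrite ltr01 lexx.
  by move=> /(_ y) nZ; have [/nZ|[t ->]] := boundaryVimage (H (y, 1)); [|exists t].
have hc : unit_continuous (fun y (t : K) => i (C (r y, t))).
  move=> y t t01 B /i_cont CB; have [U yU [e e0 UB]] := Cc _ _ t01 _ CB.
  have [||V yV [d d0 VU]] := Hc y 1 _ (i @` U).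
  - by rewrite ler01 lexx.
  - by rewrite -rP; exact: nbhs_image.
  exists V => //; exists e => // y' t' Vy' t'01 t't; apply: UB => //.
  have := VU y' 1 Vy'; rewrite ler01 lexx subrr normr0 -rP.
  by move=> /(_ isT d0)[x Ux /i_inj <-].
have [|||g2 g2P] := homotopy_acyclic hc Xbar_compact (w := i w) (f := F) (k := k).
- by move=> y; rewrite C1.
- exact: dF.
- by move=> y t _ _; exact: dF.
exists (g2 - g1) => y.
rewrite linearB /= (subr_detour _ (pullback (fun y => H (y, 1)) F)).
apply: vanish_nearB.
  suff -> : pullback (fun y => H (y, 1)) F = pullback (fun y => i (C (r y, 0))) F.
    exact: (g2P y I).
  by congr (pullback _ F); apply/funext => y'; rewrite C0 rP.
have := g1P y I; rewrite (_ : pullback (fun y => H (y, 0)) F = F)//.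
by apply/funext => s; rewrite /pullback (eq_map H0) map_id.
Qed.

(** The connecting map of the pair: [F] is sent to [seqd F], which vanishes near [Z] and so has
    bounded support on X. Acyclicity of [Xbar] makes it bijective. *)
Lemma transgression k : subquotient_iso
  (bounded_cocycle (R := R) x0 k) (bounded_coboundary x0 k)
  (germ_cocycle Z k) (germ_coboundary Z k).
Proof.
have ZP F m : (forall y, Z y -> vanish_near m F y) <->
    (forall a : set_type Z, vanish_near m F (val a)).
  split=> [FZ a|FZ y Zy]; first exact/FZ/set_mem/valP.
  exact: (FZ (exist _ y (mem_set Zy))).
exists (fun b F => [/\ bounded_cocycle x0 k b, germ_cocycle Z k F &
  forall t, vanish_near k.+1 (pullback i (seqd F) - b) t]).
split=> [a b b' F F' [bZ FZ bF] [b'Z F'Z b'F']|b F [bZ FZ bF]|b bZ|F FZ].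
- split=> [|y|t].
  + have [[[n bn] db] [[n' bn'] db']] := (bZ, b'Z); split=> [|t].
      exists (maxn n n') => t nt; apply: vanish_near_linear; [apply: bn|apply: bn'].
        by rewrite (le_lt_trans _ nt)// ler_nat leq_maxl.
      by rewrite (le_lt_trans _ nt)// ler_nat leq_maxr.
    by rewrite linearP; exact: vanish_near_linear.
  + by rewrite linearP; exact: vanish_near_linear.
  + have -> : pullback i (seqd (a *: F + F')) - (a *: b + b') =
        a *: (pullback i (seqd F) - b) + (pullback i (seqd F') - b').
      by rewrite linearP scalerBr addrACA -opprD.
    exact: vanish_near_linear.
- split=> //; split=> [[e [eB e0 be]]|[E [E0 /ZP EP]]].
    (* [F - E] is a cocycle on all of [Xbar]: near [Z] because [E] vanishes there, on X because
       [seqd F], [b], [seqd e] and [seqd E] have the same germs. *)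
    have [E [EZ E0 Ee]] := bounded_support_extend eB e0.
    have [|F' F'P] := @compactification_acyclic k (F - E).
      apply: vanish_everywhere => [y Zy|t].
        rewrite linearB; apply: vanish_nearB; first exact: (iffRL (ZP _ _) FZ).
        exact/vanish_near_seqd/EZ.
      have -> : pullback i (seqd (F - E)) = (pullback i (seqd F) - b) + (b - seqd e) -
          seqd (pullback i E - e).
        rewrite subrKA linearB linearB /= seqd_pullback.
        by rewrite opprB addrA subrK.
      apply: vanish_nearB; last exact: vanish_near_seqd.
      exact: vanish_nearD.
    exists F'; split=> [k0|a].
      have := F'P (i x0); rewrite k0 => /vanish_near0.
      by rewrite !fctE /= E0// subr0.
    rewrite -[F](subrK E) addrAC; apply: vanish_nearD; first exact: F'P.
    exact/EZ/set_mem/valP.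
  exists (pullback i (F - seqd E)); split=> [|k0|t].
  + exact: bounded_support_restrict.
  + exact: E0.
  + rewrite seqd_pullback linearB /= seqdK subr0.
    by rewrite -opprB; apply: vanish_nearN.
- have [bB db] := bZ.
  have [//|B [BZ _ Bb]] := bounded_support_extend bB.
  have [|F FP] := @compactification_acyclic k.+1 B.
    apply: vanish_everywhere => [y Zy|t]; first exact/vanish_near_seqd/BZ.
    rewrite -seqd_pullback -(subrK b (pullback i B)) linearD.
    by apply: vanish_nearD => //; exact: vanish_near_seqd.
  have FE : seqd F = B - (B - seqd F) by rewrite subKr.
  exists F; split=> //.
    by apply/ZP => y Zy; rewrite FE; apply: vanish_nearB => //; exact: BZ.
  move=> t; have -> : pullback i (seqd F) - b =
      (pullback i B - b) - pullback i (B - seqd F).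
    by apply/funext => s; rewrite {1}FE /pullback !fctE addrAC.
  by apply: vanish_nearB => //; apply/vanish_near_i.
- exists (pullback i (seqd F)); split=> //.
    split; first by apply: bounded_support_restrict; exact/ZP.
    by move=> t; rewrite seqd_pullback seqdK; exact: vanish_near_zero.
  by move=> t; rewrite subrr; exact: vanish_near_zero.
Qed.

End Compactification.

(** * Comparison with the cohomology modules *)

Section CohomologyIso.
Variables (R : comNzRingType).

Definition cocycle_set (C : cochain_complex R) n : set (C n) :=
  [set x | differential C n x = 0].
Definition coboundary_set (C : cochain_complex R) n : set (C n) :=
  match n with
  | 0 => [set 0]
  | m.+1 => [set x | exists y : C m, differential C m y = x]
  end.

Lemma in_coboundary (C : cochain_complex R) n (x : submod (@cocycle R C n)) :
  x \in @coboundary R C n <-> coboundary_set (val x).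
Proof.
case: n x => [|n] x /=; rewrite unfold_in /=.
  split=> [/eqP->//|x0]; apply/eqP/val_inj; exact: x0.
by split=> [/asboolP//|?]; apply/asboolP.
Qed.

Lemma cohomology_iso (C D : cochain_complex R) n :
  subquotient_iso (@cocycle_set C n) (@coboundary_set C n)
    (@cocycle_set D n) (@coboundary_set D n) ->
  lmod_isomorphic (cohomology C n) (cohomology D n).
Proof.
move=> [Rel [Rlin RZ Rl Rr]].
have [/choice[f fP] /choice[g gP]] : (forall v : submod (@cocycle R C n),
    exists w : submod (@cocycle R D n), Rel (val v) (val w)) /\
    forall w : submod (@cocycle R D n),
    exists v : submod (@cocycle R C n), Rel (val v) (val w).
  split=> [v|w].
    have [|w vw] := Rl (val v); first by apply/eqP; exact: (valP v).
    have [_ /eqP wZ _] := RZ _ _ vw.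
    by exists (exist _ w wZ).
  have [|v vw] := Rr (val w); first by apply/eqP; exact: (valP w).
  have [/eqP vZ _ _] := RZ _ _ vw.
  by exists (exist _ v vZ).
(* Linearity of [Rel], applied to differences, turns agreement on coboundaries into agreement on
   classes. *)
have RB (v v' : submod (@cocycle R C n)) (w w' : submod (@cocycle R D n)) :
    Rel (val v) (val w) -> Rel (val v') (val w') ->
    to_quot (@coboundary R C n) v = to_quot _ v' <->
    to_quot (@coboundary R D n) w = to_quot _ w'.
  move=> vw vw'; have := Rlin (-1) _ _ _ _ vw' vw.
  rewrite !scaleN1r ![- _ + _]addrC => /RZ[_ _ BB].
  by split=> /to_quot_eqP/in_coboundary/BB ?; apply/to_quot_eqP/in_coboundary.
pose F (x : cohomology C n) : cohomology D n := to_quot _ (f (of_quot x)).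
pose F' (y : cohomology D n) : cohomology C n := to_quot _ (g (of_quot y)).
have Flin : linear F.
  move=> a x y; rewrite /F -linearP.
  have vw := Rlin a _ _ _ _ (fP (of_quot x)) (fP (of_quot y)).
  have e := (RB _ (a *: of_quot x + of_quot y) _ (a *: f (of_quot x) + f (of_quot y))
    (fP (of_quot (a *: x + y))) vw).1.
  by apply: e; rewrite linearP /= !of_quotK.
pose HF := GRing.isLinear.Build R _ _ _ F Flin.
pose Fl : {linear cohomology C n -> cohomology D n} := HB.pack F HF.
exists Fl; exists F' => [x|y].
  rewrite /= /F' -[RHS]of_quotK.
  by apply: (RB _ _ _ _ (gP _) (fP _)).2; rewrite of_quotK.
rewrite /= /F -[RHS]of_quotK.
by apply: (RB _ _ _ _ (fP _) (gP _)).1; rewrite of_quotK.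
Qed.

End CohomologyIso.

(** * Functions of tuples and functions of sequences *)

Section Tuples.
Variables (R : comNzRingType) (T : Type).
Implicit Types (f : seq T -> R^o).

Definition on_tuples k f : ('I_k -> T) -> R^o := fun x => f (map x (enum 'I_k)).
Arguments on_tuples : clear implicits.

Lemma on_tuples_is_linear k : linear (@on_tuples k).
Proof. by []. Qed.

HB.instance Definition _ k := GRing.isLinear.Build R
  (seq T -> R^o) (('I_k -> T) -> R^o) _ (@on_tuples k) (@on_tuples_is_linear k).

Lemma on_tuplesP k (phi : ('I_k -> T) -> R^o) : exists f, on_tuples k f = phi.
Proof.
exists (fun s => oapp (fun t : k.-tuple T => phi (tnth t)) 0 (insub s)).
apply/funext => x; have sx : size (map x (enum 'I_k)) == k.
  by rewrite size_map size_enum_ord.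
rewrite /on_tuples (insubT (fun s => size s == k) sx) /=.
congr phi; apply/funext => j.
by rewrite (tnth_nth (x j)) /= (nth_map j) ?size_enum_ord// nth_ord_enum.
Qed.

Lemma map_tuple_seq k (s : seq T) : size s = k -> exists x : 'I_k -> T, s = map x (enum 'I_k).
Proof.
by move=> sk; exists (tnth (@Tuple k T s (introT eqP sk))); rewrite map_tnth_enum.
Qed.

Lemma all_in_tuple k (A : set T) (x : 'I_k -> T) :
  all_in A (map x (enum 'I_k)) <-> forall j, A (x j).
Proof.
rewrite all_in_map; split=> [xA j|xA]; last by elim: (enum _) => //= y s IH; split.
have := mem_enum 'I_k j; rewrite inE; elim: (enum _) xA => //= y s IH [Ay sA].
by rewrite inE => /orP[/eqP->//|/IH]; exact.
Qed.

(** Omitting vertex 0 gives the first term; the other faces keep it, and their signs are opposite to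
    those for the remaining tuple. *)
Lemma on_tuples_seqd k f : simplicial_d (on_tuples k f) = on_tuples k.+1 (seqd f).
Proof.
apply/funext => x; rewrite /simplicial_d /on_tuples.
elim: k f x => [|k IH] f x.
  by rewrite big_ord1 enum_ordSl /= expr0 scale1r enum_ord0 /= subr0.
rewrite big_ord_recl (enum_ordSl k.+1) /= expr0 scale1r -map_comp; congr (f _ + _).
rewrite -(IH (fun l => f (x ord0 :: l))) -sumrN.
apply: eq_bigr => j _; rewrite exprS mulN1r scaleNr; congr (- (_ *: f _)).
rewrite enum_ordSl /=; congr (x _ :: _); first exact: val_inj.
rewrite -!map_comp; apply: eq_map => l /=; congr (x _).
by apply: val_inj; rewrite /= /bump /=; lia.
Qed.

End Tuples.
Arguments on_tuples {R T} k f.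

Section AlexanderSpanierIso.
Variables (R : comNzRingType) (T : topologicalType).
Implicit Types (f : seq T -> R^o).

Lemma on_tuples_locally_zero k f : on_tuples k f \in @locally_zero R T k <->
  (k = 0 -> f [::] = 0) /\ forall t, vanish_near k f t.
Proof.
case: k => [|k]; rewrite unfold_in /=.
  split=> [/eqP f0|[f0 _]].
    have fn : f [::] = 0.
      have := congr1 (fun g => g (fun j : 'I_0 => False_rect T (notF (ltn_ord j)))) f0.
      by rewrite /on_tuples enum_ord0.
    by split=> // t; exact/vanish_near0.
  by apply/eqP/funext => x; rewrite /on_tuples enum_ord0; exact: f0.
split=> [/asboolP fP|[_ fP]].
  split=> // t; have [A tA fA] := fP t; exists A => // s /map_tuple_seq[x ->] /all_in_tuple.
  exact: fA.
by apply/asboolP => t; have [A tA fA] := fP t; exists A => // x xA;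
  apply: fA; [rewrite size_map size_enum_ord|exact/all_in_tuple].
Qed.

Lemma AS_iso k : subquotient_iso (@AS_cocycle R T k) (@AS_coboundary R T k)
  (@cocycle_set R (augmented_AS_complex R T) k)
  (@coboundary_set R (augmented_AS_complex R T) k).
Proof.
have dE m f : differential (augmented_AS_complex R T) m (to_quot _ (on_tuples m f)) =
    to_quot _ (on_tuples m.+1 (seqd f)).
  by rewrite -on_tuples_seqd /= quotmod_mapE.
have q0 m f : to_quot (@locally_zero R T m) (on_tuples m f) = 0 <->
    (m = 0 -> f [::] = 0) /\ forall t, vanish_near m f t.
  rewrite -on_tuples_locally_zero -{2}[on_tuples m f]subr0 -to_quot_eqP linear0.
  by split.
have surj m (y : augmented_AS_complex R T m) : exists f, y = to_quot _ (on_tuples m f).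
  by have [f fE] := on_tuplesP (of_quot y); exists f; rewrite fE of_quotK.
have ZE f : AS_cocycle k f <->
    cocycle_set (C := augmented_AS_complex R T) (to_quot _ (on_tuples k f)).
  rewrite /cocycle_set /= dE q0; split=> [fZ|[]//]; split=> //.
exists (fun f q => AS_cocycle k f /\ q = to_quot (@locally_zero R T k) (on_tuples k f)).
split=> [a f f' _ _ [fZ ->] [f'Z ->]|f _ [fZ ->]|f fZ|q qZ].
- split; last by rewrite !linearP.
  by move=> t; rewrite linearP; exact: vanish_near_linear.
- split=> //; first exact/ZE.
  case: k {ZE fZ} f => [|k] f /=.
    rewrite q0; split=> [[e [f0 eP]]|[f0 fP]].
      by split=> // t; apply/vanish_near0; exact: f0.
    by exists 0; split=> // t; rewrite linear0 subr0.
  split=> [[e [_ eP]]|[y]].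
    exists (to_quot _ (on_tuples k e)); rewrite dE; apply/esym/eqP.
    by rewrite -subr_eq0 -!linearB; apply/eqP/q0.
  have [e ->] := surj k y; rewrite dE => /eqP; rewrite eq_sym -subr_eq0 -!linearB.
  by move=> /eqP/q0[_ ef]; exists e.
- by exists (to_quot _ (on_tuples k f)).
- have [f qE] := surj k q; exists f; split=> //; apply/ZE; rewrite -qE//.
Qed.

End AlexanderSpanierIso.

(** * Group cochains as an edge of the double complex *)

Section GroupIso.
Variables (K : realType) (G : groupType) (X : metricType K) (R : comNzRingType).
Variables (o : G -> X).
Local Notation M := (group_ring G R).
Implicit Types (phi : seq G -> seq X -> R^o).

Definition coef (h : G) (c : M) : R^o := (val c : G -> R^o) h.

Lemma coef_is_linear h : linear (coef h).
Proof.
have L : linear (fun c : submod (@finitely_supported G R) => (val c h : R^o)).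
  by move=> a u v; rewrite linearP.
exact: L.
Qed.

HB.instance Definition _ h := GRing.isLinear.Build R M R^o _ (coef h) (coef_is_linear h).

Definition coef1 k (v : group_cochain M k) : ('I_k.+1 -> G) -> R^o :=
  fun x => coef 1%g (val v x).

Lemma val_group_cochain k : linear (fun v : group_cochain M k => val v).
Proof.
have L : linear (fun c : submod (@equivariant G R M k) => val c).
  by move=> a u v; rewrite linearP.
exact: L.
Qed.

Lemma coef1_is_linear k : linear (@coef1 k).
Proof.
move=> a u v; apply/funext => x; rewrite /coef1 val_group_cochain.
have -> : (a *: val u + val v) x = a *: val u x + val v x by [].
by rewrite linearP.
Qed.

HB.instance Definition _ k := GRing.isLinear.Build R
  (group_cochain M k) (('I_k.+1 -> G) -> R^o) _ (@coef1 k) (@coef1_is_linear k).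

Lemma coef_act h g (c : M) : coef h (gact M g c) = coef (g^-1 * h)%g c.
Proof. by []. Qed.

Lemma coefE k (v : group_cochain M k) x h :
  coef h (val v x) = coef1 v (fun j => h^-1 * x j)%g.
Proof.
have /asboolP vE : val v \in @equivariant G R M k by exact: valP.
by rewrite /coef1 vE coef_act invgK mulg1.
Qed.

Lemma coef1_inj k (v : group_cochain M k) : coef1 v = 0 -> v = 0.
Proof.
move=> v0; apply/val_inj/funext => x; apply/val_inj/funext => h.
by have := coefE v x h; rewrite v0.
Qed.

Lemma coef1_d k (v : group_cochain M k) : coef1 (group_d M k v) = simplicial_d (coef1 v).
Proof.
apply/funext => x; rewrite /coef1.
have -> : val (group_d M k v) x = simplicial_d (val v) x by [].
by rewrite linear_sum; apply: eq_bigr => j _; rewrite linearZ.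
Qed.

(* An equivariant v is determined by the coefficients at 1 of its values. *)
Definition represents k (v : group_cochain M k) phi :=
  coef1 v = on_tuples k.+1 (fun l => phi l [::]).

Lemma map_mul_tuple k (x : 'I_k -> G) h :
  [seq (h * g)%g | g <- map x (enum 'I_k)] = map (fun j => h * x j)%g (enum 'I_k).
Proof. by rewrite -map_comp. Qed.

(** By [coefE], the h at which [phi] is non-zero on the translate of x by h are the inverses of the
    support of [v x]. *)
Lemma represents_bi_cochain k (v : group_cochain M k) phi :
  represents v phi -> bi_cochain o k.+1 0 phi.
Proof.
move=> vphi; split=> // _ /map_tuple_seq[x ->] r.
have /asboolP vfin : (val (val v x) : G -> R^o) \in @finitely_supported G R by exact: valP.
apply: (@sub_finite_set _ _ ((fun h => h^-1)%g @` [set h | coef h (val v x) != 0])).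
  move=> h [t _ nt]; exists (h^-1)%g; rewrite ?invgK//=; apply/eqP => v0.
  apply: nt; apply/vanish_near0; rewrite map_mul_tuple.
  by have := congr1 (fun g => g (fun j => h * x j)%g) vphi; rewrite /on_tuples => <-;
    rewrite -v0 coefE invgK.
exact: finite_image.
Qed.

Lemma represents_exists k (v : group_cochain M k) : exists phi, represents v phi.
Proof. by have [f fE] := on_tuplesP (coef1 v); exists (fun l _ => f l). Qed.

Lemma bi_cochain_represented k phi : bi_cochain o k.+1 0 phi ->
  exists v : group_cochain M k, represents v phi.
Proof.
move=> [phiP _].
(* By [coefE], equivariance forces this formula for the coefficient at h. *)
pose a (x : 'I_k.+1 -> G) (h : G) : R^o := phi [seq (h^-1 * x j)%g | j <- enum 'I_k.+1] [::].
have afin x : a x \in @finitely_supported G R.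
  apply/asboolP; have fin := phiP (map x (enum 'I_k.+1)) _ 0.
  apply: (@sub_finite_set _ _ ((fun h => h^-1)%g @` _))
    (finite_image _ (fin _)) => [h /= /eqP ah|].
    exists (h^-1)%g; last by rewrite invgK.
    exists (o h^-1)%g; first by rewrite mdistxx.
    by move=> /vanish_near0; rewrite map_mul_tuple.
  by rewrite size_map size_enum_ord.
pose m (x : 'I_k.+1 -> G) : M := exist _ (a x) (afin x).
have aeq : m \in @equivariant G R M k.
  apply/asboolP => g x; apply/val_inj/funext => h.
  rewrite /= /left_translate /a; congr (phi _ _).
  by apply: eq_map => j; rewrite invgM invgK mulgA.
exists (exist (fun f => f \in @equivariant G R M k) m aeq).
apply/funext => x; rewrite /coef1 /coef /= /a /on_tuples.
by congr (phi _ _); apply: eq_map => j; rewrite invg1 mul1g.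
Qed.

Lemma represents_d k (v : group_cochain M k) phi :
  represents v phi -> represents (group_d M k v) (seqd phi).
Proof.
move=> vphi; rewrite /represents coef1_d vphi on_tuples_seqd.
by congr on_tuples; apply/funext => l; rewrite seqd_eval.
Qed.

Lemma represents_null k (v : group_cochain M k) phi :
  represents v phi -> v = 0 <-> bi_null k.+1 0 phi.
Proof.
move=> vphi; split=> [v0 _ /map_tuple_seq[x ->] t|phi0].
  apply/vanish_near0; have := congr1 (fun g => g x) vphi.
  by rewrite v0 linear0 /on_tuples => <-.
apply: coef1_inj; rewrite vphi; apply/funext => x.
have : vanish_near 0 (phi (map x (enum 'I_k.+1))) (o 1%g).
  by apply: phi0; rewrite size_map size_enum_ord.
by move=> /vanish_near0.
Qed.

Lemma bi_null_dX0 p phi : bi_null p 1 (dX phi) <-> bi_null p 0 phi.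
Proof.
split=> phi0; last exact: bi_null_dX.
move=> x xp t; apply/vanish_near0.
have [A tA /(_ [:: t] erefl)] := phi0 x xp t.
by rewrite /dX /= subr0; apply; split=> //; exact: nbhs_singleton.
Qed.

Lemma group_iso k : subquotient_iso
  (@cocycle_set R (group_complex M) k) (@coboundary_set R (group_complex M) k)
  (bi_cocycle (R := R) o k.+1 0) (bi_boundary o k.+1 0).
Proof.
have ZE (v : group_cochain M k) phi : represents v phi ->
    cocycle_set (C := group_complex M) v <-> bi_cocycle o k.+1 0 phi.
  move=> vphi; have vphi' := represents_null (represents_d vphi).
  split=> [/vphi' dphi|[_]]; last by rewrite seqd_dX => /bi_null_dX0/vphi'.
  split; first exact: represents_bi_cochain vphi.
  by rewrite seqd_dX; apply/bi_null_dX0.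
exists (fun v phi => bi_cocycle o k.+1 0 phi /\ represents v phi).
split=> [a v v' phi phi' [fZ vf] [f'Z vf']|v phi [fZ vf]|v vZ|phi fZ].
- split; first exact: bi_cocycle_linear.
  by rewrite /represents linearP /= vf vf'.
- split=> //; first exact/(ZE _ _ vf).
  case: k v vf {ZE fZ} => [|k] v vf /=.
    (* There are no coboundaries in degree 0: [u] has bidegree (0, 0), where cochains are zero. *)
    split=> [v0|[u [w [[_ u0] wE uw]]]].
      exists 0, 0; split; [exact: bi_cochain0|by []|].
      rewrite (linear0 (@seqd _ _ _)) subr0 (linear0 (@dX K G X R)) subr0.
      exact/(represents_null vf).
    apply/(represents_null vf) => x x1 t; have := uw x x1 t.
    rewrite wE linear0 subr0 => /vanish_near0 uwx; apply/vanish_near0; rewrite -uwx.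
    by case: x x1 {uwx} => [|g [|? ?]]//= _; rewrite !fctE /= !fctE u0//= subr0 subr0.
  split=> [[w wv]|[u [w [uD wE uw]]]].
    have [psi wpsi] := represents_exists w.
    exists psi, 0; split=> //; first exact: represents_bi_cochain wpsi.
    rewrite linear0 subr0.
    apply/(represents_null (v := v - group_d M k w)); last by rewrite -wv subrr.
    by rewrite /represents linearB /= vf (represents_d wpsi).
  have [w' w'u] := bi_cochain_represented uD.
  exists w'; apply/esym/eqP; rewrite -subr_eq0; apply/eqP.
  apply/(represents_null (phi := phi - seqd u)); last by move: uw; rewrite wE linear0 subr0.
  by rewrite /represents linearB /= vf (represents_d w'u).
- have [phi vf] := represents_exists v; exists phi; split=> //; exact/(ZE _ _ vf).
- by have [v vf] := bi_cochain_represented fZ.1; exists v.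
Qed.

End GroupIso.

(** * Orbit maps of coarse near-actions *)

Section OrbitMap.
Variables (K : realType) (G : groupType) (X : metricType K) (psi : G -> X -> X) (x0 : X).

Lemma orbit_finite : proper_near_action psi ->
  forall y r, finite_set [set g | mdist (psi g x0) y <= r].
Proof.
(* Properness is available for positive radii only, hence the maximum with 1. *)
move=> psi_proper y r; have [|n nP] := psi_proper (Num.max r 1).
  by rewrite lt_max ltr01 orbT.
apply: (@sub_finite_set _ _
  [set g | psi g @` cball x0 (Num.max r 1) `&` cball y (Num.max r 1) !=set0]).
  move=> g /= gy; exists (psi g x0); split.
    by exists x0; rewrite // /cball /= mdistxx le_max ler01 orbT.
  by rewrite /cball /= metric_sym le_max gy.
by apply: card_le_finite (nP x0 y) _; exact: finite_II.
Qed.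

Hypothesis psi_action : coarse_near_action psi.

(** Up to the error C, [psi h] carries the orbit point of [h^-1 * g] to that of g and [x0] to that
    of h; the lower control function then confines the former to a ball around [x0]. *)
Lemma orbit_mull : proper_near_action psi -> forall r, exists2 E, finite_set E &
  forall h g, mdist (psi h x0) (psi g x0) <= r -> exists2 e, E e & g = (h * e)%g.
Proof.
move=> psi_proper r.
have [C [lo [up [C0 [lo0 lo_homo up_homo loy] _ psiM psi_emb]]]] := psi_action.
have [s [_ sP]] : \forall s \near +oo, C + r < lo s by move/cvgryPgt: loy; exact.
exists [set e | mdist (psi e x0) x0 <= s]; first exact: orbit_finite.
move=> h g hg; exists (h^-1 * g)%g; last by rewrite mulgA mulgV mul1g.
rewrite /= leNgt; apply/negP => /sP; apply/negP; rewrite -leNgt.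
have /andP[+ _] := psi_emb h (psi (h^-1 * g)%g x0) x0; move=> /le_trans; apply.
rewrite (le_trans (metric_triangle _ (psi g x0) _))// lerD//; last by rewrite metric_sym.
by rewrite metric_sym; have := psiM h (h^-1 * g)%g x0; rewrite mulgA mulgV mul1g.
Qed.

Lemma orbit_mulr a : exists k, forall h, mdist (psi (h * a)%g x0) (psi h x0) <= k.
Proof.
have [C [lo [up [C0 _ _ psiM psi_emb]]]] := psi_action.
exists (C + up (mdist (psi a x0) x0)) => h.
rewrite (le_trans (metric_triangle _ (psi h (psi a x0)) _))// lerD//.
by have /andP[] := psi_emb h (psi a x0) x0.
Qed.

End OrbitMap.

(** The index k is the same on both sides, but it is degree k on the left and degree k - 1 on the
    right, where the augmentation occupies index 0. *)
Lemma group_boundary_iso (K : realType) (G : groupType) (X : metricType K)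
    (Xbar : topologicalType) (i : X -> Xbar) (psi : G -> X -> X)
    (R : comNzRingType) (k : nat) :
  cZ_structure i psi ->
  lmod_isomorphic (cohomology (group_complex (group_ring G R)) k)
                  (cohomology (augmented_AS_complex R (boundary i)) k).
Proof.
move=> [[[Xproper Xcocompact [_ Xcontr]] [icomp Zset] _] psi_action
  [x0 [R0 [_ cob]]] psi_proper].
have /choice[c cP] y : exists g, mdist (psi g x0) y <= R0.
  by have [g /ltW] := cob y; exists g.
have o_finite := orbit_finite x0 psi_proper.
have o_mull := orbit_mull x0 psi_action psi_proper.
have o_mulr := orbit_mulr x0 psi_action.
have X_fill : exists S : nat -> nat, forall (b : X) k (f : seq X -> R^o),
    (forall x, vanish_near k.+2 (seqd f) x) ->
    exists g, (forall x, vanish_near k.+1 (f - seqd g) x) /\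
      forall n, (forall x, mdist b x <= (S n)%:R -> vanish_near k.+1 f x) ->
        forall x, mdist b x <= n%:R -> vanish_near k g x.
  have [S SP] := uniform_contraction Xproper Xcocompact Xcontr.
  by exists (fun n => radius S n.+1) => b m f; exact: (fill Xproper (SP b)).
apply: cohomology_iso; apply: subquotient_iso_trans (group_iso R (fun g => psi g x0) k) _.
apply: subquotient_iso_trans (bi_staircase o_finite o_mull o_mulr cP X_fill 0 k.+1) _.
apply: subquotient_iso_trans (bi_bounded_iso R x0 o_finite cP k) _.
apply: subquotient_iso_trans (transgression R x0 Xproper Xcontr icomp Zset k) _.
have [_ [_ Xbar_metrizable] _ _] := icomp; have [Zclosed _] := Zset.
apply: subquotient_iso_trans (taut R Xbar_metrizable Zclosed k) _.
exact: AS_iso.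
Qed.

Theorem theorem6p2 (K : realType) (G : groupType) (X : metricType K)
  (Xbar : topologicalType) (i : X -> Xbar) (psi : G -> X -> X)
  (hcZ : cZ_structure i psi) (n : int) (R : idomainType) (hR : is_PID R) :
  lmod_isomorphic (group_cohomology (group_ring G R) (n + 1)%R)
                  (reduced_cech_cohomology R (boundary i) n).
Proof.
rewrite /group_cohomology /reduced_cech_cohomology.
case: (n + 1)%R => m; first exact: group_boundary_iso hcZ.
(* In negative degrees both sides are the zero module by definition. *)
by exists idfun; exists idfun.
Qed.
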